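(* Let $P(y_0,y_1)\in\mathbb{C}[y_0,y_1]$ be a non-zero polynomial with constant coefficients in which $y_1$ actually occurs, defining the autonomous first order ordinary differential equation $P(y,\frac{dy}{dx})=0$. Then: (1) If $s(x)\in\Omega$ is a solution of $P=0$, then $s(x)\in\hat K^{*}$. (2) If $s(x)\in\hat K^{*}$ is a solution of $P=0$, then $s(x)$ is a convergent Puiseux power series. (3) For any point $(x_0,c_0)\in\mathbb{C}^2$ there exists an analytic solution $s(x)$ of $P=0$ passing through the point $(x_0,c_0)$.
   Context: $\Omega$ denotes the field of generalized power series $s(x)=\sum_{i\ge1}c_ix^{\mu_i}$ with $c_i\in\mathbb{C}$, $\mu_i\in\mathbb{R}$ strictly increasing and $\mu_i\to\infty$ when there are infinitely many terms. Here $y_1$ refers to the ordinary derivative $\frac{d}{dx}$, and $s$ is a solution if $P(s(x),\frac{ds}{dx}(x))=0$. $\hat K^{*}=\bigcup_{d\ge1}\mathbb{C}((x^{\frac1d\mathbb{Z}}))$ is the field of formal Puiseux power series.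
   Formalization: In (3), ''analytic solution'' is a convergent Puiseux series in x − x0 with nonnegative exponents and constant term c0, since 2yy' = 1 has no holomorphic solution through (x0,0); as the equation is autonomous, x0 is translated to the origin. *)

(* Defs.v *)
From HB Require Import structures.
From mathcomp Require Import all_boot all_order all_algebra.
From mathcomp Require Import all_classical all_reals all_analysis.
From mathcomp Require Import complex.
Set Implicit Arguments. Unset Strict Implicit. Unset Printing Implicit Defensive.
Import Order.TTheory GRing.Theory Num.Theory.
Import numFieldNormedType.Exports.
Local Open Scope classical_set_scope.
Local Open Scope ring_scope.
Local Open Scope complex_scope.

(* Throughout, R : realType is a model of the reals (any realType is
   isomorphic to R) and R[i] = complex R plays the role of C.

   A generalized power series  s(x) = sum_i c_i x^{mu_i}  is represented by
   its coefficient function  s : R -> R[i]  (s mu = coefficient of x^mu). *)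
Definition gseries (R : realType) := R -> R[i].

(* The usual (norm-induced) topology on C = R[i], as MathComp-Analysis
   equips every numFieldType. *)
HB.instance Definition _ (R : realType) :=
  PseudoPointedMetric.copy R[i] (R[i])^o.

(* Membership in Omega: the exponents with non-zero coefficients form a
   (finite, or) strictly increasing sequence tending to +oo, i.e. for every
   bound M only finitely many exponents lie below M. *)
Definition in_Omega (R : realType) (s : gseries R) : Prop :=
  forall M : R, finite_set [set m : R | m <= M /\ s m != 0].

(* Cauchy product (finite sums for elements of Omega). *)
Definition gmul (R : realType) (a b : gseries R) : gseries R :=
  fun n => \sum_(m \in [set m : R | a m != 0 /\ b (n - m) != 0]) a m * b (n - m).

Definition gone (R : realType) : gseries R := fun n => if n == 0 then 1 else 0.

Definition gpow (R : realType) (a : gseries R) (k : nat) : gseries R :=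
  iter k (gmul a) (@gone R).

Definition gderiv (R : realType) (a : gseries R) : gseries R :=
  fun n => ((n + 1)%:C) * a (n + 1).

(* A bivariate polynomial P(y0,y1) in C[y0,y1] is represented as
   P : {poly {poly R[i]}}, i.e.  P = sum_j P_j(y0) * y1^j  (outer variable
   = y1 = dy/dx, inner variable = y0 = y).  The coefficient of y0^i y1^j is
   (P`_j)`_i. *)
Definition geval (R : realType) (P : {poly {poly R[i]}}) (s : gseries R) :
  gseries R :=
  fun n => \sum_(j < size P) \sum_(i < size P`_j)
             (P`_j)`_i * gmul (gpow s i) (gpow (gderiv s) j) n.

Definition is_solution (R : realType) (P : {poly {poly R[i]}}) (s : gseries R)
  : Prop := forall n : R, geval P s n = 0.

(* s lies in  K^* = U_{d>=1} C((x^{1/d})) : all exponents lie in (1/d)Z. *)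
Definition puiseux_with (R : realType) (d : nat) (s : gseries R) : Prop :=
  (0 < d)%N /\ forall m : R, s m != 0 -> exists k : int, m = k%:~R / d%:R.

Definition is_puiseux (R : realType) (s : gseries R) : Prop :=
  exists d : nat, puiseux_with d s.

(* Convergent Puiseux series: with t = x^{1/d}, the power series
   sum_{k>=0} c_{k/d} t^k has a positive radius of convergence (the
   finitely many negative exponents do not affect convergence). *)
Definition convergent_puiseux (R : realType) (s : gseries R) : Prop :=
  exists d : nat, puiseux_with d s /\
    exists r : R, 0 < r /\
      forall t : R[i], `|t| < r%:C ->
        cvg ((fun N : nat => \sum_(0 <= k < N) s (k%:R / d%:R) * t ^+ k) @ \oo).

(* Main.v *)
(* Let [s] be a nonconstant solution and let [Q] be a polynomial of minimal degree
   in [y1] vanishing at [(s, s')], so that [B = Q_y1 (s, s')] is nonzero.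

   Rational exponents: an additive map [lam : R -> R] with [lam 1 = 0] gives a
   derivation [x^m |-> lam m x^m] commuting with [d/dx]. Its value [z] at [s]
   solves the linearised equation [A z + B z' = 0], as does [s'], so [z] is
   proportional to [s']; comparing orders, [z = 0]. Hence every such [lam]
   vanishes on the exponents of [s], which are therefore rational.

   Bounded denominators: if [t] keeps the terms of [s] with exponents in
   [(1/d) Z] and [z = s - t], the leading exponent of the linear part of
   [Q (t, t') - Q (s, s')] lies outside [(1/d) Z] unless [z = 0].

   Convergence: the equation for the tail of [s] is regular singular, hence can
   be majorised by an algebraic equation.

   Existence: if [P (c0, 0)] is zero, take a constant. Otherwise some root [y1] of
   [P (c0 + w, y1)] has a Puiseux expansion of order at most [0] in [w], and its
   inverse is a power series [zeta] in [t = w^(1/d)]. Separating variables, [t] as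
   a function of [x] is found by inverting the primitive of
   [zeta (t) d t^(d-1)]. *)
Require Import Defs.
From HB Require Import structures.
From mathcomp Require Import all_boot all_order all_algebra.
From mathcomp Require Import all_classical all_reals all_analysis.
From mathcomp Require Import complex.
From mathcomp Require Import ring lra.
Set Implicit Arguments. Unset Strict Implicit. Unset Printing Implicit Defensive.
Import Order.TTheory GRing.Theory Num.Theory.
Local Open Scope classical_set_scope.
Local Open Scope ring_scope.
Local Open Scope complex_scope.

(** One indicial factor carries the last two arguments on a given solution. Let [mu] be the order of
    [s - s(0)] and [beta] that of [B]. Since [s'] has order [mu - 1] and lies in the kernel of
    [A z + B z'], the coefficient of [A] at [beta - 1] is [1 - mu] times the leading coefficient of
    [B]. The operator therefore sends a leading term in [x^nu] to exponent [nu + beta - 1] with the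
    extra factor [nu - mu + 1]. This factor is nonzero for [nu > mu - 1], which detects the first
    exponent outside a lattice. It also grows linearly in [nu], just as the factor produced by
    differentiation does, and so no derivative is lost in the convergence estimate. *)

Lemma finite_set_min (R : realType) (A : set R) :
  finite_set A -> A !=set0 -> exists2 m, A m & forall x, A x -> m <= x.
Proof.
move=> /finite_seqP[s ->] {A}.
elim: s => [|y s IH] [x /=]; first by rewrite inE.
move=> _; have [s0|/eqP s0] := eqVneq s [::].
  by exists y => [|z]; rewrite s0 /= ?inE// => /eqP ->.
have [|m ms mle] := IH.
  by case: s s0 {IH} => // z s _; exists z; rewrite /= inE eqxx.
exists (Num.min y m) => [|z].
  by rewrite /= inE; case: leP => _; rewrite ?eqxx ?orTb // ms orbT.
rewrite /= inE => /orP[/eqP->|zs]; first by rewrite ge_min lexx.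
by rewrite ge_min mle ?orbT.
Qed.

Lemma in_Omega_lb (R : realType) (a : gseries R) : in_Omega a ->
  exists l, forall m, a m != 0 -> l <= m.
Proof.
move=> /(_ 0) fa.
have [e|/set0P ne] := eqVneq [set m | m <= 0 /\ a m != 0] set0.
  exists 0 => m am; rewrite leNgt; apply/negP => m0.
  have : [set m | m <= 0 /\ a m != 0] m by split=> //; exact: ltW.
  by rewrite e.
have [l [l0 _] lle] := finite_set_min fa ne.
exists l => m am; have [m0|/ltW m0] := leP m 0; first exact: lle.
exact: le_trans m0.
Qed.

Lemma finite_mul_supp (R : realType) (a b : gseries R) (n : R) :
  in_Omega a -> in_Omega b -> finite_set [set m | a m != 0 /\ b (n - m) != 0].
Proof.
move=> oa /in_Omega_lb [l lP].
apply: sub_finite_set (oa (n - l)) => m /= [am bm]; split => //.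
by move: (lP _ bm); lra.
Qed.

(** Finitely supported sums ignore zero terms, so any set containing the support may serve as index
    set. This puts several products on one common set. *)
Lemma gmulE (R : realType) (a b : gseries R) (n : R) (A : set R) :
  (forall m, a m != 0 -> b (n - m) != 0 -> A m) ->
  gmul a b n = \sum_(m \in A) a m * b (n - m).
Proof.
move=> sA; apply: fsbig_widen => [m /= [am bm]|m /= [_ /not_andP H]].
  exact: sA.
by apply/eqP; rewrite mulf_eq0; case: H => /negP; rewrite negbK => ->; rewrite ?orbT.
Qed.

Lemma gmulT (R : realType) (a b : gseries R) (n : R) :
  gmul a b n = \sum_(m \in [set: R]) a m * b (n - m).
Proof. exact: gmulE. Qed.

Lemma in_Omega_gmul (R : realType) (a b : gseries R) :
  in_Omega a -> in_Omega b -> in_Omega (gmul a b).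
Proof.
move=> oa ob M.
have [la laP] := in_Omega_lb oa; have [lb lbP] := in_Omega_lb ob.
apply: sub_finite_set (finite_image2 +%R (oa (M - lb)) (ob (M - la))).
move=> n /= [nM]; rewrite gmulT => nz.
have [m _] := @fsbigN1 _ _ _ _ _ setT (fun n m => a m * b (n - m)) n nz.
rewrite mulf_eq0 negb_or => /andP[am bm].
exists m; first by split=> //; move: (lbP _ bm); lra.
exists (n - m); first by split=> //; move: (laP _ am); lra.
by rewrite addrC subrK.
Qed.

Lemma gmulC (R : realType) (a b : gseries R) : gmul a b = gmul b a.
Proof.
apply/funext => n; rewrite !gmulT (reindex_fsbigT (fun m : R => n - m)).
  by apply: eq_fsbigr => m _; rewrite mulrC; congr (b _ * _); ring.
by exists (fun m : R => n - m) => m; ring.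
Qed.

Lemma gmulDr (R : realType) (a b c : gseries R) :
  in_Omega a -> in_Omega b -> in_Omega c ->
  gmul a (fun n => b n + c n) = (fun n => gmul a b n + gmul a c n).
Proof.
move=> oa ob oc; apply/funext => n.
pose A := [set m | a m != 0 /\ b (n - m) != 0] `|`
          [set m | a m != 0 /\ c (n - m) != 0].
have fA : finite_set A by rewrite finite_setU; split; exact: finite_mul_supp.
rewrite !(@gmulE _ _ _ _ A).
- by rewrite -fsbig_split//; apply: eq_fsbigr => m _; rewrite mulrDr.
- by move=> m am cm; right.
- by move=> m am bm; left.
- move=> m am; have [b0|b0 _] := eqVneq (b (n - m)) 0; last by left.
  by rewrite /= b0 add0r => c0; right.
Qed.

Lemma gmulA (R : realType) (a b c : gseries R) :
  in_Omega a -> in_Omega b -> in_Omega c ->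
  gmul a (gmul b c) = gmul (gmul a b) c.
Proof.
move=> oa ob oc; apply/funext => n.
have [la laP] := in_Omega_lb oa; have [lb lbP] := in_Omega_lb ob.
have [lc lcP] := in_Omega_lb oc.
(* If the coefficients at [x], [y] and [n - x - y] are all nonzero, the lower bounds force [x] into
   [A] and [y] into [B]. Both are finite, which justifies the exchange of sums. *)
pose A := [set m | m <= n - lb - lc /\ a m != 0].
pose B := [set m | m <= n - la - lc /\ b m != 0].
pose S := [set x + y | x in A & y in B].
have fA : finite_set A by exact: oa.
have fB : finite_set B by exact: ob.
have fS : finite_set S by exact: finite_image2.
have inS x y : a x != 0 -> b y != 0 -> c (n - x - y) != 0 -> A x /\ S (x + y).
  move=> ax by_ cy.
  move: (laP _ ax) (lbP _ by_) (lcP _ cy) => h1 h2 h3.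
  have Ax : A x by split=> //; lra.
  split=> //; exists x => //; exists y => //; split=> //; lra.
have bcN x : gmul b c (n - x) != 0 -> exists y, b y != 0 /\ c (n - x - y) != 0.
  rewrite gmulT => /(@fsbigN1 _ _ _ _ _ setT (fun n m => b m * c (n - m)) _)[y _].
  by rewrite mulf_eq0 negb_or => /andP[? ?]; exists y.
have abN m : gmul a b m != 0 -> exists x, a x != 0 /\ b (m - x) != 0.
  rewrite gmulT => /(@fsbigN1 _ _ _ _ _ setT (fun n m => a m * b (n - m)) _)[y _].
  by rewrite mulf_eq0 negb_or => /andP[? ?]; exists y.
rewrite (@gmulE _ _ _ _ A); last first.
  by move=> x ax /bcN[y [by_ cy]]; have [] := inS _ _ ax by_ cy.
rewrite (@gmulE _ (gmul a b) _ _ S); last first.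
  move=> m /abN[x [ax bx]] cm.
  have [|_] := inS x (m - x) ax bx; last by rewrite addrC subrK.
  by rewrite (_ : n - x - (m - x) = n - m) //; ring.
transitivity (\sum_(x \in A) \sum_(m \in S) a x * b (m - x) * c (n - m)).
  apply: eq_fsbigr => x _.
  have [a0|a0] := eqVneq (a x) 0.
    by rewrite a0 mul0r fsbig1// => m _; rewrite !mul0r.
  under eq_fsbigr do rewrite -mulrA.
  rewrite -mulr_fsumr; congr (_ * _).
  rewrite gmulT (reindex_fsbigT (fun m : R => m - x)); last first.
    by exists (fun m : R => m + x) => m; ring.
  apply/esym; rewrite (@fsbig_widen _ _ _ _ S setT) //=.
    by apply: eq_fsbigr => m _; congr (_ * c _); ring.
  move=> m [_ nS] /=; apply/eqP; apply: contra_notT nS.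
  rewrite mulf_eq0 negb_or => /andP[bm cm].
  have [|_] := inS x (m - x) a0 bm; last by rewrite addrC subrK.
  by rewrite (_ : n - x - (m - x) = n - m) //; ring.
rewrite exchange_fsbig//; apply: eq_fsbigr => m _.
rewrite -mulr_fsuml.
have [c0|c0] := eqVneq (c (n - m)) 0; first by rewrite c0 !mulr0.
congr (_ * _).
rewrite (@gmulE _ _ _ _ A)// => x ax bx.
have [|Ax _ //] := inS x (m - x) ax bx.
by rewrite (_ : n - x - (m - x) = n - m) //; ring.
Qed.

(** * The ring of generalized power series *)

(** Bundling the support condition makes Omega a type that can carry a commutative ring
    structure. *)
Record omega (R : realType) := MkOmega { oser :> R -> R[i]; oserP : in_Omega oser }.

HB.instance Definition _ (R : realType) := gen_eqMixin (omega R).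
HB.instance Definition _ (R : realType) := gen_choiceMixin (omega R).

Section OmegaRing.
Variable R : realType.
Local Notation C := R[i].
Implicit Types (a b : omega R) (c d : C) (m n : R).

Lemma omegaP a b : (forall m, a m = b m) -> a = b.
Proof.
case: a b => [a oa] [b ob] /= /funext ab; subst b.
by congr MkOmega; exact: Prop_irrelevance.
Qed.

Lemma in_Omega_sub (f g : R -> C) : in_Omega f ->
  (forall m, g m != 0 -> f m != 0) -> in_Omega g.
Proof.
move=> of_ fg M; apply: sub_finite_set (of_ M) => m /= [mM gm].
by split=> //; exact: fg.
Qed.

Lemma in_Omega_finite (f : R -> C) : finite_set [set m | f m != 0] -> in_Omega f.
Proof. by move=> ff M; apply: sub_finite_set ff => m [_]. Qed.

Lemma in_Omega_mono (c : C) (mu : R) : in_Omega (fun m => if m == mu then c else 0).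
Proof.
apply: in_Omega_finite; apply: sub_finite_set (finite_set1 mu) => m /=.
by case: (m =P mu) => // _; rewrite eqxx.
Qed.

Lemma in_OmegaD a b : in_Omega (fun m => a m + b m).
Proof.
move=> M; apply: (@sub_finite_set _ _
  ([set m | m <= M /\ a m != 0] `|` [set m | m <= M /\ b m != 0])).
  move=> m /= [mM]; have [->|a0] := eqVneq (a m) 0; last by left.
  by rewrite add0r; right.
by rewrite finite_setU; split; exact: oserP.
Qed.

Lemma in_OmegaN a : in_Omega (fun m => - a m).
Proof. by apply: in_Omega_sub (oserP a) _ => m; rewrite oppr_eq0. Qed.

Lemma in_Omega0 : in_Omega (fun _ : R => 0 : C).
Proof. by apply: in_Omega_sub (in_Omega_mono 0 0) _ => m /=; rewrite eqxx. Qed.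

Definition mono (c : C) (mu : R) : omega R := MkOmega (in_Omega_mono c mu).

Let oadd a b : omega R := MkOmega (in_OmegaD a b).
Let oopp a : omega R := MkOmega (in_OmegaN a).
Let ozero : omega R := MkOmega in_Omega0.

Let oaddA : associative oadd.
Proof. by move=> a b c; apply: omegaP => m /=; rewrite addrA. Qed.
Let oaddC : commutative oadd.
Proof. by move=> a b; apply: omegaP => m /=; rewrite addrC. Qed.
Let oadd0 : left_id ozero oadd.
Proof. by move=> a; apply: omegaP => m /=; rewrite add0r. Qed.
Let oaddN : left_inverse ozero oopp oadd.
Proof. by move=> a; apply: omegaP => m /=; rewrite addNr. Qed.

HB.instance Definition _ := GRing.isZmodule.Build (omega R) oaddA oaddC oadd0 oaddN.

Let omul a b : omega R := MkOmega (in_Omega_gmul (oserP a) (oserP b)).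
Let oone : omega R := mono 1 0.

Lemma gmul_mono (c : C) (mu : R) a n : gmul (mono c mu) a n = c * a (n - mu).
Proof.
rewrite (@gmulE _ _ _ _ [set mu]) ?fsbig_set1 /= ?eqxx// => m /=.
by case: (m =P mu) => // _; rewrite eqxx.
Qed.

Let omulA : associative omul.
Proof.
move=> a b c; apply: omegaP => m.
by rewrite /= (gmulA (oserP a) (oserP b) (oserP c)).
Qed.
Let omulC : commutative omul.
Proof. by move=> a b; apply: omegaP => m /=; rewrite gmulC. Qed.
Let omul1 : left_id oone omul.
Proof.
by move=> a; apply: omegaP => m; rewrite [LHS]gmul_mono mul1r subr0.
Qed.
Let omulDl : left_distributive omul oadd.
Proof.
move=> a b c; apply: omegaP => m /=.
rewrite gmulC (gmulDr (oserP c) (oserP a) (oserP b)).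
by rewrite (gmulC a c) (gmulC b c).
Qed.
Let oone_neq0 : oone != ozero.
Proof.
apply/eqP => /(congr1 (fun a : omega R => a 0)) /= /eqP.
by rewrite eqxx oner_eq0.
Qed.

HB.instance Definition _ := GRing.Zmodule_isComNzRing.Build (omega R)
  omulA omulC omul1 omulDl oone_neq0.

Lemma ocoef0 m : (0 : omega R) m = 0. Proof. by []. Qed.
Lemma ocoefD a b m : (a + b) m = a m + b m. Proof. by []. Qed.
Lemma ocoefN a m : (- a) m = - a m. Proof. by []. Qed.
Lemma ocoefB a b m : (a - b) m = a m - b m. Proof. by []. Qed.
Lemma ocoefM a b m : (a * b) m = gmul a b m. Proof. by []. Qed.
Lemma coef_mono c mu m : mono c mu m = if m == mu then c else 0. Proof. by []. Qed.
Lemma ocoef1 m : (1 : omega R) m = if m == 0 then 1 else 0. Proof. by []. Qed.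

Lemma ocoef_sum (I : Type) (r : seq I) (Q : pred I) (F : I -> omega R) m :
  (\sum_(i <- r | Q i) F i) m = \sum_(i <- r | Q i) F i m.
Proof. exact: (big_morph (fun a : omega R => a m) (fun a b => ocoefD a b m)). Qed.

Lemma coef_monoM c mu a m : (mono c mu * a) m = c * a (m - mu).
Proof. by rewrite ocoefM gmul_mono. Qed.

Lemma mono_mul c d mu nu : mono c mu * mono d nu = mono (c * d) (mu + nu).
Proof.
apply: omegaP => m; rewrite coef_monoM !coef_mono subr_eq addrC.
by case: eqP; rewrite ?mulr0.
Qed.

Lemma monoX mu k : mono 1 mu ^+ k = mono 1 (mu *+ k).
Proof.
elim: k => [|k IH]; first by rewrite expr0 mulr0n.
by rewrite exprS IH mono_mul mulr1 mulrS.
Qed.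

Definition oC (c : C) : omega R := mono c 0.

Lemma coef_oCM c a m : (oC c * a) m = c * a m.
Proof. by rewrite coef_monoM subr0. Qed.

Lemma oC_is_zmod_morphism : zmod_morphism oC.
Proof.
move=> c d; apply: omegaP => m; rewrite ocoefB !coef_mono.
by case: eqP; rewrite ?subr0.
Qed.
Lemma oC_is_monoid_morphism : monoid_morphism oC.
Proof. by split=> // c d; rewrite /oC mono_mul addr0. Qed.
HB.instance Definition _ := GRing.isZmodMorphism.Build C (omega R) oC
  oC_is_zmod_morphism.
HB.instance Definition _ := GRing.isMonoidMorphism.Build C (omega R) oC
  oC_is_monoid_morphism.

Lemma monoK mu a : mono 1 (- mu) * (mono 1 mu * a) = a.
Proof. by rewrite mulrA mono_mul mulr1 addNr mul1r. Qed.

(** Order at least [M], phrased as vanishing below [M] so that it also holds of the zero series. *)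
Definition vge a (M : R) := forall m, m < M -> a m = 0.

Lemma vgeW a M N : N <= M -> vge a M -> vge a N.
Proof. by move=> NM va m mN; apply: va; exact: lt_le_trans NM. Qed.
Lemma vgeD a b M : vge a M -> vge b M -> vge (a + b) M.
Proof. by move=> va vb m mM; rewrite ocoefD va// vb// addr0. Qed.
Lemma vgeN a M : vge a M -> vge (- a) M.
Proof. by move=> va m mM; rewrite ocoefN va// oppr0. Qed.
Lemma vgeB a b M : vge a M -> vge b M -> vge (a - b) M.
Proof. by move=> va vb; apply: vgeD => //; exact: vgeN. Qed.
Lemma vge_sum (I : Type) (r : seq I) (Q : pred I) (F : I -> omega R) M :
  (forall i, Q i -> vge (F i) M) -> vge (\sum_(i <- r | Q i) F i) M.
Proof.
move=> vF; apply: (big_ind (fun a => vge a M)) => //.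
by move=> a b; exact: vgeD.
Qed.
Lemma vgeM a b M N : vge a M -> vge b N -> vge (a * b) (M + N).
Proof.
move=> va vb m mMN; rewrite ocoefM gmulT fsbig1// => k _.
have [kM|Mk] := ltP k M; first by rewrite va// mul0r.
by rewrite vb ?mulr0//; lra.
Qed.
Lemma vge_lb a : exists M, vge a M.
Proof.
have [l lP] := in_Omega_lb (oserP a); exists l => m ml; apply/eqP.
by apply: contraTT ml => /lP; rewrite leNgt.
Qed.
Lemma vge_mono c mu : vge (mono c mu) mu.
Proof. by move=> m mmu; rewrite coef_mono; case: eqP mmu => // ->; rewrite ltxx. Qed.
Lemma vge_oC c : vge (oC c) 0. Proof. exact: vge_mono. Qed.
Lemma vge1 : vge 1 0. Proof. exact: vge_mono. Qed.
Lemma vgeX a M k : vge a M -> vge (a ^+ k) (M *+ k).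
Proof.
move=> va; elim: k => [|k IH]; first by rewrite expr0 mulr0n; exact: vge1.
by rewrite exprS mulrS; exact: vgeM.
Qed.
Lemma vge_monoM c mu a M : vge a M -> vge (mono c mu * a) (mu + M).
Proof. by apply: vgeM; exact: vge_mono. Qed.
(** [M] and [N] are only lower bounds for the orders: [a M] or [b N] may vanish, so the formula
    reads off the coefficient at a prescribed weight. *)
Lemma ocoefM_lead a b M N : vge a M -> vge b N -> (a * b) (M + N) = a M * b N.
Proof.
move=> va vb; rewrite ocoefM (@gmulE _ _ _ _ [set M]).
  by rewrite fsbig_set1 addrAC subrr add0r.
move=> k ak bk /=; apply/eqP; rewrite eq_le.
rewrite !leNgt; apply/andP; split; apply/negP => kM.
  by move: bk; rewrite vb ?eqxx//; lra.
by move: ak; rewrite va ?eqxx.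
Qed.

Lemma lead_exists a : a != 0 -> exists2 mu, a mu != 0 & vge a mu.
Proof.
move=> /eqP a0; have [k ak] : exists k, a k != 0.
  apply: contrapT => H; apply: a0; apply: omegaP => m; apply/eqP.
  by apply: contrapT => /negP am; apply: H; exists m.
have [|m [mk am] mle] := finite_set_min (oserP a k); first by exists k.
exists m => // j jm; apply/eqP; apply: contraTT jm => aj; rewrite -leNgt.
by have [jk|/ltW] := leP j k; [exact: mle|exact: le_trans].
Qed.

Lemma omega_mul_eq0 a b : a * b = 0 -> a = 0 \/ b = 0.
Proof.
move=> ab; have [->|/lead_exists[M aM va]] := eqVneq a 0; first by left.
have [->|/lead_exists[N bN vb]] := eqVneq b 0; first by right.
move: (ocoefM_lead va vb); rewrite ab ocoef0 => /esym/eqP.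
by rewrite mulf_eq0 (negPf aM) (negPf bN).
Qed.

Lemma in_Omega_restr (A : set R) a : in_Omega (fun m => if m \in A then a m else 0).
Proof. by apply: in_Omega_sub (oserP a) _ => m; case: ifP; rewrite ?eqxx. Qed.

(** Used with two kinds of sets: a lattice of exponents, and a half-line that truncates a series. *)
Definition restr (A : set R) a : omega R := MkOmega (in_Omega_restr A a).

Lemma coef_restr A a m : restr A a m = if m \in A then a m else 0. Proof. by []. Qed.

(** * Derivations of the ring *)

Lemma in_Omega_delta (lam : R -> C) a : in_Omega (fun m => lam m * a m).
Proof.
by apply: in_Omega_sub (oserP a) _ => m; rewrite mulf_eq0 negb_or => /andP[].
Qed.

Definition delta (lam : R -> C) a : omega R := MkOmega (in_Omega_delta lam a).

Lemma coef_delta lam a m : delta lam a m = lam m * a m. Proof. by []. Qed.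

Lemma deltaD lam a b : delta lam (a + b) = delta lam a + delta lam b.
Proof. by apply: omegaP => m; rewrite ocoefD !coef_delta ocoefD mulrDr. Qed.

Lemma deltaM (lam : R -> C) a b : {morph lam : x y / x + y} ->
  delta lam (a * b) = delta lam a * b + a * delta lam b.
Proof.
move=> lD; apply: omegaP => n; rewrite ocoefD coef_delta !ocoefM.
pose A := [set m | a m != 0 /\ b (n - m) != 0].
have fA : finite_set A by apply: finite_mul_supp; exact: oserP.
rewrite !(@gmulE _ _ _ _ A) //; last first.
- by move=> m; rewrite coef_delta mulf_eq0 negb_or => /andP[].
- by move=> m am; rewrite coef_delta mulf_eq0 negb_or => /andP[].
rewrite mulr_fsumr -fsbig_split//; apply: eq_fsbigr => m _.
have -> : lam n = lam (n - m) + lam m by rewrite -lD subrK.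
by rewrite !coef_delta /=; ring.
Qed.

Lemma delta_oC (lam : R -> C) c : {morph lam : x y / x + y} -> delta lam (oC c) = 0.
Proof.
move=> lD; have l0 : lam 0 = 0 by apply: (addIr (lam 0)); rewrite -lD !add0r.
apply: omegaP => m; rewrite coef_delta coef_mono ocoef0.
by case: eqP => [->|_]; rewrite ?l0 ?mul0r ?mulr0.
Qed.

Lemma vge_delta lam a M : vge a M -> vge (delta lam a) M.
Proof. by move=> va m mM; rewrite coef_delta va// mulr0. Qed.

Lemma in_Omega_gderiv a : in_Omega (gderiv a).
Proof.
move=> M; apply: (@sub_finite_set _ _
  ((fun m => m - 1) @` [set m | m <= M + 1 /\ a m != 0])).
  move=> m /= [mM]; rewrite /gderiv mulf_eq0 negb_or => /andP[_ am].
  by exists (m + 1); [split=> //; rewrite lerD2r | rewrite addrK].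
by apply: finite_image; exact: oserP.
Qed.

Definition oD a : omega R := MkOmega (in_Omega_gderiv a).

Lemma coef_oD a m : oD a m = (m + 1)%:C * a (m + 1). Proof. by []. Qed.

(** Up to the factor [x^(-1)], [d/dx] is the Euler operator, a [delta] for the additive map
    [m |-> m]; the Leibniz rule is inherited from [deltaM]. *)
Lemma oDE a : oD a = mono 1 (-1) * delta (fun m => m%:C) a.
Proof.
by apply: omegaP => m; rewrite coef_monoM coef_delta coef_oD mul1r opprK.
Qed.

Lemma realCD : {morph (fun m : R => m%:C) : x y / x + y}.
Proof. by move=> x y; rewrite rmorphD. Qed.

Lemma oDD a b : oD (a + b) = oD a + oD b.
Proof. by rewrite !oDE deltaD mulrDr. Qed.
Lemma oDM a b : oD (a * b) = oD a * b + a * oD b.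
Proof. rewrite !oDE (deltaM _ _ realCD); ring. Qed.
Lemma oD_oC c : oD (oC c) = 0.
Proof. by rewrite oDE (delta_oC _ realCD) mulr0. Qed.
Lemma oDN a : oD (- a) = - oD a.
Proof. by apply: omegaP => m; rewrite ocoefN !coef_oD ocoefN mulrN. Qed.
Lemma oDB a b : oD (a - b) = oD a - oD b.
Proof. by rewrite oDD oDN. Qed.
Lemma vge_oD a M : vge a M -> vge (oD a) (M - 1).
Proof. by move=> va m mM; rewrite coef_oD va ?mulr0//; lra. Qed.
Lemma coef_oDB a M : oD a (M - 1) = M%:C * a M.
Proof. by rewrite coef_oD subrK. Qed.

End OmegaRing.

(** * Evaluation of differential polynomials *)

Section Evaluation.
Variable R : realType.
Local Notation C := R[i].
Implicit Types (a b h k : omega R) (p q : {poly C}) (P Q : {poly {poly C}}).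

Definition ev0 a p : omega R := (map_poly (@oC R) p).[a].

Lemma ev0_is_zmod_morphism a : zmod_morphism (ev0 a).
Proof. by move=> p q; rewrite /ev0 rmorphB hornerD hornerN. Qed.
Lemma ev0_is_monoid_morphism a : monoid_morphism (ev0 a).
Proof.
by split=> [|p q]; rewrite /ev0 ?rmorph1 ?hornerC// rmorphM hornerM.
Qed.
HB.instance Definition _ a := GRing.isZmodMorphism.Build {poly C} (omega R) (ev0 a)
  (ev0_is_zmod_morphism a).
HB.instance Definition _ a := GRing.isMonoidMorphism.Build {poly C} (omega R) (ev0 a)
  (ev0_is_monoid_morphism a).

Lemma ev0C a c : ev0 a c%:P = oC c. Proof. by rewrite /ev0 map_polyC hornerC. Qed.
Lemma ev0X a : ev0 a 'X = a. Proof. by rewrite /ev0 map_polyX hornerX. Qed.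

Lemma ev0_sum a p n : (size p <= n)%N -> ev0 a p = \sum_(i < n) oC p`_i * a ^+ i.
Proof.
move=> sp; rewrite /ev0 (@horner_coef_wide _ n); last first.
  exact: leq_trans (size_poly _ _) sp.
by apply: eq_bigr => i _; rewrite coef_map.
Qed.

Definition ev P a b : omega R := (map_poly (ev0 a) P).[b].

Lemma ev_sum0 P a b n : (size P <= n)%N -> ev P a b = \sum_(j < n) ev0 a P`_j * b ^+ j.
Proof.
move=> sP; rewrite /ev (@horner_coef_wide _ n); last first.
  exact: leq_trans (size_poly _ _) sP.
by apply: eq_bigr => i _; rewrite coef_map.
Qed.

(** A common bound for both degrees turns expansions into sums over a square. [bisz_exists] supplies
    it as [n.+2], so that the terms of degree 0 and 1 can be split off. *)
Definition bisz n P := (size P <= n)%N /\ forall j, (size (P`_j)%R <= n)%N.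

Lemma bisz_exists P : exists n, bisz n.+2 P.
Proof.
exists (size P + \max_(j < size P) size (P`_j)%R)%N; split.
  by rewrite -addn2 -addnA leq_addr.
move=> j; have [jP|Pj] := ltnP j (size P); last by rewrite nth_default// size_poly0.
rewrite -addn2 -addnA addnC -addnA addnCA; apply: leq_trans (leq_addl _ _).
rewrite addnC; apply: leq_trans (leq_addl _ _).
exact: (@leq_bigmax _ (fun j : 'I_(size P) => size P`_j) (Ordinal jP)).
Qed.

Lemma ev_sum P a b n : bisz n P ->
  ev P a b = \sum_(j < n) \sum_(i < n) oC (P`_j)`_i * (a ^+ i * b ^+ j).
Proof.
move=> [sP sPj]; rewrite (@ev_sum0 _ _ _ n)//; apply: eq_bigr => j _.
rewrite (@ev0_sum _ _ n)// mulr_suml; apply: eq_bigr => i _.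
by rewrite mulrA.
Qed.

Lemma gpowE a n : gpow a n = (a ^+ n : omega R).
Proof.
elim: n => [|n IH]; first by apply/funext.
by rewrite exprS /= -IH.
Qed.

Lemma gevalE P a m : geval P a m = ev P a (oD a) m.
Proof.
rewrite (@ev_sum0 _ _ _ (size P))// ocoef_sum; apply: eq_bigr => j _.
rewrite (@ev0_sum _ _ (size P`_j))// mulr_suml ocoef_sum; apply: eq_bigr => i _.
by rewrite -mulrA coef_oCM ocoefM -gpowE -(gpowE (oD a)).
Qed.

Lemma is_solutionE P a : is_solution P a <-> ev P a (oD a) = 0.
Proof.
split=> [sol|e n]; last by rewrite gevalE e.
by apply: omegaP => m; rewrite -gevalE sol.
Qed.

Definition derivation (d : omega R -> omega R) :=
  [/\ {morph d : a b / a + b}, (forall a b, d (a * b) = d a * b + a * d b) &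
      forall c, d (oC c) = 0].

Lemma derivation_oD : derivation (@oD R).
Proof. by split; [exact: oDD|exact: oDM|exact: oD_oC]. Qed.

Lemma derivation_delta (lam : R -> C) : {morph lam : x y / x + y} ->
  derivation (delta lam).
Proof.
by move=> lD; split=> *; [exact: deltaD|exact: deltaM|exact: delta_oC].
Qed.

Lemma derivation_ev0 d a p : derivation d -> d (ev0 a p) = ev0 a p^`() * d a.
Proof.
move=> [dD dM dC]; elim/poly_ind: p => [|p c IH].
  by rewrite deriv0 !rmorph0 mul0r -[RHS](dC 0) rmorph0.
rewrite rmorphD rmorphM /= ev0C ev0X dD dM dC IH addr0.
rewrite derivD derivM derivX derivC addr0 mulr1 rmorphD rmorphM /= ev0X; ring.
Qed.

Lemma map_deriv_MX P : map_poly deriv (P * 'X) = map_poly deriv P * 'X.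
Proof.
apply/polyP => i; rewrite coef_map !coefMX.
by case: i => [|i] /=; rewrite ?deriv0// coef_map.
Qed.

Lemma evD P Q a b : ev (P + Q) a b = ev P a b + ev Q a b.
Proof. by rewrite /ev rmorphD hornerD. Qed.
Lemma evM P Q a b : ev (P * Q) a b = ev P a b * ev Q a b.
Proof. by rewrite /ev rmorphM hornerM. Qed.
Lemma evC p a b : ev p%:P a b = ev0 a p.
Proof. by rewrite /ev map_polyC hornerC. Qed.
Lemma evX a b : ev 'X a b = b.
Proof. by rewrite /ev map_polyX hornerX. Qed.

Lemma derivation_ev d P a b : derivation d ->
  d (ev P a b) = ev (map_poly deriv P) a b * d a + ev P^`() a b * d b.
Proof.
move=> dd; have [dD dM dC] := dd; elim/poly_ind: P => [|P p IH].
  rewrite (raddf0 (map_poly deriv)) deriv0 /ev rmorph0 !horner0 !mul0r addr0.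
  by rewrite -[RHS](dC 0) rmorph0.
rewrite (raddfD (map_poly deriv)) /= map_deriv_MX map_polyC /=.
rewrite derivD derivM derivX derivC mulr1 addr0 !evD !evM !evC evX dD dM IH.
rewrite (derivation_ev0 _ _ dd); ring.
Qed.

(** The divided derivative, with factor [1/(i! j!)], of order [i] in [y0] and [j] in [y1]. *)
Definition hasse i j P : {poly {poly C}} := map_poly (nderivn i) P^`N(j).

Lemma size_nderivn_le (S : nzRingType) (p : {poly S}) i : (size p^`N(i) <= size p)%N.
Proof. by rewrite /nderivn; apply: leq_trans (size_poly _ _) (leq_subr _ _). Qed.

Lemma bisz_hasse n i j P : bisz n P -> bisz n (hasse i j P).
Proof.
move=> [sP sPj]; split.
  by apply: leq_trans (size_poly _ _) (leq_trans (size_nderivn_le _ _) _).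
move=> l; rewrite coef_map; apply: leq_trans (size_nderivn_le _ _) _.
rewrite coef_nderivn; apply: leq_trans (sPj (j + l)%N).
apply/leq_sizeP => u hu.
by rewrite coefMn (nth_default 0 hu) mul0rn.
Qed.

Lemma taylor P a b h k n : bisz n P ->
  ev P (a + h) (b + k) =
  \sum_(j < n) \sum_(i < n) ev (hasse i j P) a b * h ^+ i * k ^+ j.
Proof.
move=> bP; have [sP sPj] := bP.
rewrite {1}/ev (@nderiv_taylor_wide _ n); last 2 first.
- exact: mulrC.
- exact: leq_trans (size_poly _ _) sP.
apply: eq_bigr => j _; rewrite -mulr_suml; congr (_ * _).
rewrite nderivn_map -/(ev _ _ _).
have bN : bisz n P^`N(j).
  split; first exact: leq_trans (size_nderivn_le _ _) sP.
  move=> l; rewrite coef_nderivn; apply: leq_trans (sPj (j + l)%N).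
  by apply/leq_sizeP => u hu; rewrite coefMn (nth_default 0 hu) mul0rn.
have [sN sNj] := bN.
rewrite (@ev_sum0 _ _ _ n)//.
transitivity (\sum_(l < n) \sum_(i < n) ev0 a (hasse i j P)`_l * b ^+ l * h ^+ i).
  apply: eq_bigr => l _; rewrite /ev0 (@nderiv_taylor_wide _ n); last 2 first.
  - exact: mulrC.
  - exact: leq_trans (size_poly _ _) (sNj _).
  rewrite mulr_suml; apply: eq_bigr => i _.
  rewrite /hasse coef_map nderivn_map; ring.
rewrite exchange_big; apply: eq_bigr => i _; rewrite -mulr_suml; congr (_ * _).
by rewrite (@ev_sum0 _ _ _ n)//; have [] := bisz_hasse i j bP.
Qed.

Lemma hasse00 P : hasse 0 0 P = P.
Proof. by apply/polyP => i; rewrite /hasse nderivn0 coef_map /= nderivn0. Qed.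
Lemma hasse10 P : hasse 1 0 P = map_poly deriv P.
Proof. by apply/polyP => i; rewrite /hasse nderivn0 !coef_map /= nderivn1. Qed.
Lemma hasse01 P : hasse 0 1 P = P^`().
Proof. by apply/polyP => i; rewrite /hasse nderivn1 coef_map /= nderivn0. Qed.

(** Both powers in a monomial have exponent below [n], hence order at least [- e n]. The bound is
    crude, but it is the same for all Hasse derivatives of [P]. *)
Lemma vge_ev P n (e : R) a b : 0 <= e -> bisz n P -> vge a (- e) -> vge b (- e) ->
  vge (ev P a b) (- (e *+ (n + n))).
Proof.
move=> e0 bP va vb; rewrite (ev_sum _ _ bP).
apply: vge_sum => j _; apply: vge_sum => i _.
have -> : - (e *+ (n + n)) = 0 + (- (e *+ n) + - (e *+ n)) by rewrite mulrnDr; ring.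
apply: vgeM; first exact: vge_oC.
have le_e (l : 'I_n) : - (e *+ n) <= (- e) *+ l.
  by rewrite mulNrn lerN2 ler_wpMn2l // ltnW.
by apply: vgeM; [apply: vgeW (le_e i) _ | apply: vgeW (le_e j) _]; exact: vgeX.
Qed.

(** For an additive submonoid [G] the series supported in [G] form a subring. This is applied to the
    rationals, to [(1/d) Z] and to [(1/d) N]. *)
Definition supp_in (G : set R) a := forall m, a m != 0 -> G m.

Section SuppIn.
Variable G : set R.
Hypotheses (G0 : G 0) (GD : forall x y, G x -> G y -> G (x + y)).

Lemma supp_in0 : supp_in G 0. Proof. by move=> m; rewrite ocoef0 eqxx. Qed.
Lemma supp_in_mono c mu : G mu -> supp_in G (mono c mu).
Proof. by move=> Gmu m; rewrite coef_mono; case: (m =P mu) => [->//|_]; rewrite eqxx. Qed.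
Lemma supp_in_oC c : supp_in G (oC c). Proof. exact: supp_in_mono. Qed.
Lemma supp_in1 : supp_in G 1. Proof. exact: supp_in_oC. Qed.
Lemma supp_inD a b : supp_in G a -> supp_in G b -> supp_in G (a + b).
Proof.
move=> sa sb m; rewrite ocoefD; have [-> |/sa //] := eqVneq (a m) 0.
by rewrite add0r => /sb.
Qed.
Lemma supp_inN a : supp_in G a -> supp_in G (- a).
Proof. by move=> sa m; rewrite ocoefN oppr_eq0 => /sa. Qed.
Lemma supp_inB a b : supp_in G a -> supp_in G b -> supp_in G (a - b).
Proof. by move=> sa sb; apply: supp_inD => //; exact: supp_inN. Qed.
Lemma supp_in_sum (I : Type) (r : seq I) (T : pred I) (F : I -> omega R) :
  (forall i, T i -> supp_in G (F i)) -> supp_in G (\sum_(i <- r | T i) F i).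
Proof.
move=> vF; apply: (big_ind (supp_in G)) => //; first exact: supp_in0.
by move=> a b; exact: supp_inD.
Qed.
Lemma supp_inM a b : supp_in G a -> supp_in G b -> supp_in G (a * b).
Proof.
move=> sa sb m; rewrite ocoefM gmulT.
move=> /(@fsbigN1 _ _ _ _ _ setT (fun n m => a m * b (n - m)) _)[y _].
rewrite mulf_eq0 negb_or => /andP[/sa Gy /sb Gmy].
by rewrite -(subrK y m); exact: GD.
Qed.
Lemma supp_inX a n : supp_in G a -> supp_in G (a ^+ n).
Proof.
move=> sa; elim: n => [|n IH]; first by rewrite expr0; exact: supp_in1.
by rewrite exprS; exact: supp_inM.
Qed.
Lemma supp_in_horner (f : {poly omega R}) a :
  (forall i, supp_in G f`_i) -> supp_in G a -> supp_in G f.[a].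
Proof.
move=> sf sa; rewrite horner_coef; apply: supp_in_sum => i _.
by apply: supp_inM => //; exact: supp_inX.
Qed.
Lemma supp_in_ev0 a p : supp_in G a -> supp_in G (ev0 a p).
Proof.
by move=> sa; apply: supp_in_horner => // i; rewrite coef_map; exact: supp_in_oC.
Qed.
Lemma supp_in_ev P a b : supp_in G a -> supp_in G b -> supp_in G (ev P a b).
Proof.
by move=> sa sb; apply: supp_in_horner => // i; rewrite coef_map; exact: supp_in_ev0.
Qed.
Lemma supp_in_delta lam a : supp_in G a -> supp_in G (delta lam a).
Proof. by move=> sa m; rewrite coef_delta mulf_eq0 negb_or => /andP[_ /sa]. Qed.
Lemma supp_in_oD a : G (-1) -> supp_in G a -> supp_in G (oD a).
Proof.
move=> G1 sa; rewrite oDE; apply: supp_inM; first exact: supp_in_mono.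
exact: supp_in_delta.
Qed.
End SuppIn.

(** Over the complex numbers [p] splits into linear factors, and Omega is a domain, so some factor
    [a - z] vanishes. *)
Lemma algebraic_const a p : p != 0 -> ev0 a p = 0 -> exists c, a = oC c.
Proof.
move=> p0; have [r pE] := closed_field_poly_normal p.
have lp : lead_coef p != 0 by rewrite lead_coef_eq0.
rewrite pE -mul_polyC rmorphM /= ev0C => /omega_mul_eq0[].
  move/(congr1 (fun a : omega R => a 0)); rewrite coef_mono eqxx ocoef0.
  by move/eqP; rewrite (negPf lp).
elim: r {pE} => [|z r IH].
  by rewrite big_nil rmorph1 => /eqP; rewrite oner_eq0.
rewrite big_cons rmorphM => /omega_mul_eq0[|//].
by rewrite rmorphB /= ev0X ev0C => /eqP; rewrite subr_eq0 => /eqP; exists z.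
Qed.

(** Differentiate in [y1] until the next derivative no longer vanishes at [(a, b)]. The descent
    cannot reach zero: in characteristic 0 a zero derivative leaves a polynomial in [y0] alone,
    which would make [a] constant. *)
Lemma separant_exists P a b : P != 0 -> ev P a b = 0 -> (forall c, a <> oC c) ->
  exists2 Q, ev Q a b = 0 & ev Q^`() a b != 0.
Proof.
move=> + + nc; have [n] := ubnP (size P); elim: n P => // n IH P sP P0 eP.
have [e|ne] := eqVneq (ev P^`() a b) 0; last by exists P.
have [d0|d0] := eqVneq P^`() 0; last first.
  by apply: (IH P^`()) => //; exact: leq_trans (lt_size_deriv P0) sP.
have s1 : (size P <= 1)%N.
  apply/leq_sizeP => -[//|j _]; apply/polyP => i; apply/eqP.
  move: (congr1 (fun Q : {poly {poly C}} => Q`_j`_i) d0).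
  by rewrite coef_deriv coefMn !coef0 => /eqP; rewrite mulrn_eq0.
move: P0 eP; rewrite (size1_polyC s1) evC polyC_eq0 => p0 /(algebraic_const p0)[c].
by move/nc.
Qed.

End Evaluation.

(** * Exponents of solutions *)

Section Rationality.
Variable R : realType.
Local Notation C := R[i].
Implicit Types (a b z s : omega R) (Q : {poly {poly C}}).

Definition rational (m : R) := exists q : rat, m = ratr q.

(** Take a rational subspace [A] maximal among those with [m] outside [A + Q]. Then [1] lies in [A]
    and the reals are the direct sum of [A] and the line [Q m]; [lam] is the coordinate along
    [m]. *)
Lemma additive_functional (m : R) : ~ rational m ->
  exists lam : R -> R, [/\ {morph lam : x y / x + y}, lam 1 = 0 & lam m = 1].
Proof.
move=> mN.
pose lc (V : set R) := forall (p q : rat) x y, V x -> V y -> V (ratr p * x + ratr q * y).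
pose T (V : set R) := lc V /\ forall v q, V v -> v + ratr q <> m.
have [F FT totF|A [[lA mA] Amax]] := @Zorn_bigcup R T.
  split=> [p q x y [X FX Xx] [Y FY Yy]|v q [X FX Xv]]; last exact: (FT X FX).2.
  have [XY|YX] := totF _ _ FX FY.
    by exists Y => //; apply: (FT Y FY).1 => //; exact: XY.
  by exists X => //; apply: (FT X FX).1 => //; exact: YX.
have TQ : T [set x | rational x].
  split=> [p q _ _ [u ->] [v ->]|v q [u ->] e].
    by exists (p * u + q * v); rewrite rmorphD !rmorphM.
  by apply: mN; exists (u + q); rewrite rmorphD.
(* The empty set satisfies [T], as it must for the union of the empty chain, so nonemptiness has to
   come from maximality. *)
have [v0 Av0] : A !=set0.
  apply/set0P/eqP => A0; apply: (Amax _ _ TQ); rewrite A0; split=> //.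
  by move=> /(_ 0); apply; exists 0; rewrite rmorph0.
have A0 : A 0 by have := lA 0 0 _ _ Av0 Av0; rewrite rmorph0 !mul0r addr0.
have lA1 x y : A x -> A y -> A (x + y).
  by move=> Ax Ay; have := lA 1 1 _ _ Ax Ay; rewrite rmorph1 !mul1r.
have lAZ q x : A x -> A (ratr q * x).
  by move=> Ax; have := lA q 0 _ _ Ax Ax; rewrite rmorph0 mul0r addr0.
have lAN x : A x -> A (- x).
  by move=> Ax; have := lAZ (-1) _ Ax; rewrite rmorphN rmorph1 mulN1r.
have ext y : ~ A y -> ~ T [set v + ratr q * y | v in A & q in [set: rat]].
  move=> nAy; apply: Amax; split=> [v Av|sub].
    by exists v => //; exists 0 => //; rewrite rmorph0 mul0r addr0.
  apply: nAy; apply: sub; exists 0 => //; exists 1 => //.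
  by rewrite rmorph1 mul1r add0r.
have extl y : lc [set v + ratr q * y | v in A & q in [set: rat]].
  move=> p q _ _ [v Av [p' _ <-]] [w Aw [q' _ <-]].
  exists (ratr p * v + ratr q * w); first by apply: lA1; exact: lAZ.
  by exists (p * p' + q * q') => //; rewrite rmorphD !rmorphM /=; ring.
have A1 : A 1.
  apply: contrapT => nA1; apply: (ext _ nA1); split; first exact: extl.
  move=> _ q [v Av [p _ <-]]; rewrite mulr1 -addrA -rmorphD; exact: mA.
(* For [y] outside [A], maximality yields [v + p y + q = m] with [v] in [A] and [p] nonzero, so [y]
   is congruent to [p^-1 m] modulo [A]. *)
have dec y : exists q, A (y - ratr q * m).
  have [Ay|nAy] := pselect (A y).
    by exists 0; rewrite rmorph0 mul0r subr0.
  apply: contrapT => H; apply: (ext _ nAy); split; first exact: extl.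
  move=> _ q [v Av [p _ <-]] e.
  have [p0|p0] := eqVneq p 0.
    by move: e; rewrite p0 rmorph0 mul0r addr0; exact: mA.
  have rp0 : ratr p != 0 :> R by rewrite fmorph_eq0.
  apply: H; exists p^-1.
  have -> : y - ratr p^-1 * m = - (ratr p^-1 * v + ratr (p^-1 * q) * 1).
    by rewrite -e !rmorphM !fmorphV /=; field.
  by apply: lAN; apply: lA1; exact: lAZ.
have uniqq y p q : A (y - ratr p * m) -> A (y - ratr q * m) -> p = q.
  move=> Ap Aq; apply/eqP; rewrite -subr_eq0; apply: contrapT => /negP pq0.
  have rp0 : ratr (p - q) != 0 :> R by rewrite fmorph_eq0.
  have : A m.
    have -> : m = ratr (p - q)^-1 * ((y - ratr q * m) + - (y - ratr p * m)).
      by move: rp0; rewrite fmorphV rmorphB /= => rp0; field.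
    by apply: lAZ; apply: lA1 => //; exact: lAN.
  by move=> /(mA _ 0); rewrite rmorph0 addr0; apply.
pose l y := sval (cid (dec y)); have lP y : A (y - ratr (l y) * m).
  by rewrite /l; case: cid.
exists (fun y => ratr (l y)); split.
- move=> x y; rewrite -rmorphD; congr ratr; apply: (uniqq (x + y)) => //.
  by rewrite rmorphD mulrDl opprD addrACA; exact: lA1.
- by rewrite (uniqq 1 (l 1) 0) ?rmorph0 ?mul0r ?subr0.
- by rewrite (uniqq m (l m) 1) ?rmorph1 ?mul1r ?subrr.
Qed.

(** The factor [nu - pi] shows that two nonzero series with vanishing Wronskian have the same
    order. *)
Lemma wronskian_lead z p (nu pi : R) : vge z nu -> vge p pi ->
  (oD z * p - z * oD p) (nu - 1 + pi) = (nu - pi)%:C * (z nu * p pi).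
Proof.
move=> vz vp; rewrite ocoefB (ocoefM_lead (vge_oD vz) vp).
have -> : nu - 1 + pi = nu + (pi - 1) by ring.
rewrite (ocoefM_lead vz (vge_oD vp)) !coef_oDB rmorphB /=; ring.
Qed.

(** Removing the constant term leaves a nonzero order, so differentiation does not kill the leading
    term. *)
Lemma nonconst_lead s : (forall c, s <> oC c) ->
  exists mu, [/\ mu != 0, vge (s - oC (s 0)) mu, vge (oD s) (mu - 1) &
                 oD s (mu - 1) != 0].
Proof.
move=> nc; pose w := s - oC (s 0).
have w0 : w != 0 by rewrite subr_eq0; apply/eqP; exact: nc.
have [mu wmu vw] := lead_exists w0.
have mu0 : mu != 0.
  apply: contraNneq wmu => ->; rewrite ocoefB coef_mono eqxx subrr eqxx//.
have sw : oD s = oD w by rewrite oDB oD_oC subr0.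
exists mu; rewrite sw; split=> //; first exact: vge_oD.
by rewrite coef_oDB mulf_neq0// -(rmorph0 (real_complex R)) (inj_eq (@complexI R)).
Qed.

Lemma vge_divr a b (K pi : R) : vge (a * b) K -> vge b pi -> b pi != 0 -> vge a (K - pi).
Proof.
move=> vab vb bpi.
have [->//|/lead_exists[al aal va]] := eqVneq a 0.
suff Kal : K - pi <= al by exact: vgeW va.
rewrite leNgt; apply/negP => lt; have := ocoefM_lead va vb.
rewrite vab; last by lra.
by move=> /esym/eqP; rewrite mulf_eq0 (negPf aal) (negPf bpi).
Qed.

(* Differentiating [Q (s, s') = 0] shows that [s'] is in the kernel of the
   linearised equation; this pins down the leading part of its coefficients. *)
Lemma linearization Q s : (forall c, s <> oC c) ->
  ev Q s (oD s) = 0 -> ev Q^`() s (oD s) != 0 ->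
  exists mu beta, let A := ev (map_poly deriv Q) s (oD s) in
    let B := ev Q^`() s (oD s) in
  [/\ mu != 0 /\ vge (s - oC (s 0)) mu,
      (forall d, derivation d -> d (oD s) = oD (d s) -> vge (d s) mu -> d s = 0),
      vge B beta /\ B beta != 0 & vge A (beta - 1) /\
      A (beta - 1) = (1 - mu)%:C * B beta].
Proof.
move=> nc eQ B0; have [mu [mu0 vw vp pmu]] := nonconst_lead nc.
have [beta Bb vB] := lead_exists B0.
set A := ev (map_poly deriv Q) s (oD s); set B := ev Q^`() s (oD s) in B0 Bb vB *.
have lin d : derivation d -> A * d s + B * d (oD s) = 0.
  move=> dd; rewrite -(derivation_ev _ _ _ dd) eQ.
  by have [_ _ dC] := dd; rewrite -[RHS](dC 0) rmorph0.
have linD := lin _ (derivation_oD R).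
have AE : A * oD s = - (B * oD (oD s)) by apply/eqP; rewrite -addr_eq0 linD.
(* [A] is [- B oD (oD s) / oD s], of order at least [beta + (mu - 2) - (mu - 1)]. *)
have vA : vge A (beta - 1).
  have -> : beta - 1 = (beta + (mu - 1 - 1)) - (mu - 1) by ring.
  apply: (vge_divr _ vp pmu); rewrite AE; apply: vgeN.
  by apply: vgeM => //; exact: vge_oD.
exists mu, beta; split=> //.
- move=> d dd dcom vd; apply/eqP; apply: contrapT => /negP/lead_exists[nu znu vz].
  (* Eliminating [A] between the equations for [d s] and for [oD s] leaves the Wronskian; its
     vanishing would force [nu = mu - 1], against [nu >= mu]. *)
  have : B * (oD (d s) * oD s - d s * oD (oD s)) = 0.
    have := lin d dd; rewrite dcom => e.
    have -> : B * (oD (d s) * oD s - d s * oD (oD s)) =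
      (A * d s + B * oD (d s)) * oD s - (A * oD s + B * oD (oD s)) * d s by ring.
    by rewrite e linD !mul0r subrr.
  case/omega_mul_eq0 => [/eqP|/(congr1 (fun a : omega R => a (nu - 1 + (mu - 1))))].
    by rewrite (negPf B0).
  rewrite wronskian_lead// ocoef0 => /eqP.
  rewrite mulf_eq0 (negPf (mulf_neq0 znu pmu)) orbF.
  rewrite -(rmorph0 (real_complex R)) (inj_eq (@complexI R)) => /eqP numu.
  have : mu <= nu; last by lra.
  by rewrite leNgt; apply/negP => /vd /eqP; rewrite (negPf znu).
- split=> //; have := congr1 (fun a : omega R => a ((beta - 1) + (mu - 1))) AE.
  rewrite (ocoefM_lead vA vp) ocoefN.
  have -> : (beta - 1) + (mu - 1) = beta + (mu - 1 - 1) by ring.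
  rewrite (ocoefM_lead vB (vge_oD vp)) (coef_oDB (oD s)) => e.
  by apply: (mulIf pmu); rewrite e !rmorphB /=; ring.
Qed.

Lemma rational_exponents Q s : (forall c, s <> oC c) ->
  ev Q s (oD s) = 0 -> ev Q^`() s (oD s) != 0 -> forall m, s m != 0 -> rational m.
Proof.
move=> nc eQ B0 m sm; apply: contrapT => mN.
have [lam [lD l1 lm]] := additive_functional mN.
have [mu [beta /= [[mu0 vw] ker _ _]]] := linearization nc eQ B0.
have lD' : {morph (fun x : R => (lam x)%:C) : x y / x + y}.
  by move=> x y; rewrite lD rmorphD.
have dd := derivation_delta lD'.
have /(congr1 (fun a : omega R => a m)) : delta (fun x => (lam x)%:C) s = 0.
  apply: ker => //.
    apply: omegaP => n; rewrite coef_oD !coef_delta coef_oD lD l1 addr0; ring.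
  (* An additive [lam] vanishes at [0], so the constant term may be dropped and the image has order
     at least [mu]. *)
  have -> : delta (fun x => (lam x)%:C) s = delta (fun x => (lam x)%:C) (s - oC (s 0)).
    have [dD _ dC] := dd.
    by rewrite -[RHS]addr0 -(dC (s 0)) -dD subrK.
  exact: vge_delta.
by rewrite coef_delta lm mul1r ocoef0 => /eqP; rewrite (negPf sm).
Qed.

(** * Bounded denominators *)

Definition lattice (d : nat) : set R := [set m | exists k : int, m = k%:~R / d%:R].

Lemma lattice0 d : lattice d 0. Proof. by exists 0; rewrite mul0r. Qed.
Lemma latticeD d x y : lattice d x -> lattice d y -> lattice d (x + y).
Proof. by move=> [k ->] [l ->]; exists (k + l); rewrite rmorphD mulrDl. Qed.
Lemma latticeN d x : lattice d x -> lattice d (- x).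
Proof. by move=> [k ->]; exists (- k); rewrite rmorphN mulNr. Qed.
Lemma latticeB d x y : lattice d x -> lattice d y -> lattice d (x - y).
Proof. by move=> lx ly; apply: latticeD => //; exact: latticeN. Qed.
Lemma lattice1 d : (0 < d)%N -> lattice d 1.
Proof.
by move=> d0; exists d; rewrite -pmulrn divff// pnatr_eq0 -lt0n.
Qed.
Lemma lattice_dvd d e x : (0 < e)%N -> lattice d x -> lattice (d * e) x.
Proof.
move=> e0 [k ->]; exists (k * e); rewrite rmorphM /= natrM -pmulrn.
have e0' : e%:R != 0 :> R by rewrite pnatr_eq0 -lt0n.
have [->|d0] := eqVneq d 0%N; first by rewrite mul0r invr0 !mulr0.
have d0' : d%:R != 0 :> R by rewrite pnatr_eq0.
by field; rewrite e0' d0'.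
Qed.

Lemma lattice_rational x : rational x -> exists2 d, (0 < d)%N & lattice d x.
Proof.
move=> [q ->]; exists `|denq q|%N; first by rewrite absz_gt0 denq_neq0.
exists (numq q); rewrite /ratr; congr (_ / _).
by rewrite pmulrn gez0_abs// denq_ge0.
Qed.

Lemma common_denominator (A : set R) : finite_set A ->
  (forall m, A m -> rational m) ->
  exists2 d, (0 < d)%N & forall m, A m -> lattice d m.
Proof.
move=> /finite_seqP[r ->] {A}; elim: r => [|x r IH] rat_r.
  by exists 1%N => // m; rewrite /= inE.
have [|d d0 dP] := IH; first by move=> m mr; apply: rat_r; rewrite /= inE mr orbT.
have [e e0 eP] := lattice_rational (rat_r x (mem_head _ _)).
exists (d * e)%N => [|m]; first by rewrite muln_gt0 d0.
rewrite /= inE => /orP[/eqP->|mr]; last by apply: lattice_dvd => //; exact: dP.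
by rewrite mulnC; exact: lattice_dvd.
Qed.

Lemma bound_below s b : exists2 e : R, 0 <= e & vge s (- e) /\ vge b (- e).
Proof.
have [l vl] := vge_lb s; have [l' vl'] := vge_lb b.
exists (`|l| + `|l'|); first by rewrite addr_ge0.
by split; [apply: vgeW vl|apply: vgeW vl']; move: (ler_norm (- l)) (ler_norm (- l'))
  (normr_ge0 l) (normr_ge0 l'); rewrite !normrN; lra.
Qed.

(** Each term of degree at least 2 in [h] and [k] gains [L + L] on the bound of [vge_ev]. *)
Lemma taylor2 Q a b h k n (e L : R) : 0 <= e -> 0 <= L -> bisz n.+2 Q ->
  vge a (- e) -> vge b (- e) -> vge h L -> vge k L ->
  vge (ev Q (a + h) (b + k) - (ev Q a b + ev (map_poly deriv Q) a b * h
       + ev Q^`() a b * k)) (- (e *+ (n.+2 + n.+2)) + (L + L)).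
Proof.
move=> e0 L0 bQ va vb vh vk; rewrite (taylor _ _ _ _ bQ).
set K := (X in vge _ X).
have vt i j : (1 < i + j)%N -> vge (ev (hasse i j Q) a b * h ^+ i * k ^+ j) K.
  move=> ij; rewrite -mulrA; apply: vgeM.
    by apply: vge_ev => //; exact: bisz_hasse.
  apply: (@vgeW _ _ (L *+ i + L *+ j)).
    by rewrite -mulrnDr -mulr2n ler_wpMn2l.
  by apply: vgeM; exact: vgeX.
rewrite !big_ord_recl /= !expr0 !expr1 !mulr1 hasse00 hasse10 hasse01.
set s00 := ev Q a b; set s10 := ev (map_poly deriv Q) a b * h.
set s01 := ev Q^`() a b * k.
set S1 := \sum_(i < _) _; set t11 := ev (hasse (bump 0 0) _ Q) a b * _ * _.
set S2 := \sum_(i < _) _; set S3 := \sum_(j < _) _.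
have -> : s00 + (s10 + S1) + (s01 + (t11 + S2) + S3) - (s00 + s10 + s01) =
  S1 + t11 + S2 + S3 by ring.
have v1 : vge S1 K.
  apply: vge_sum => i _; have := vt (bump 0 (bump 0 i)) 0%N; rewrite expr0 mulr1.
  by apply; rewrite /bump /= !add1n addn0.
have v2 : vge t11 K by have := vt 1%N 1%N; rewrite !expr1; apply.
have v3 : vge S2 K.
  apply: vge_sum => i _; have := vt (bump 0 (bump 0 i)) 1%N; rewrite !expr1.
  by apply; rewrite /bump /= !add1n addn1.
apply: vgeD; [apply: vgeD => //; exact: vgeD|].
apply: vge_sum => j _; apply: vge_sum => i _; apply: vt.
by rewrite /bump /= !add1n addnC.
Qed.

Lemma bounded_denominators Q s : (forall c, s <> oC c) ->
  ev Q s (oD s) = 0 -> ev Q^`() s (oD s) != 0 ->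
  exists2 d, (0 < d)%N & supp_in (lattice d) s.
Proof.
move=> nc eQ B0; have ratS := rational_exponents nc eQ B0.
have [mu [beta /= [[mu0 vw] ker [vB Bb] [vA AE]]]] := linearization nc eQ B0.
set A := ev (map_poly deriv Q) s (oD s) in vA AE.
set B := ev Q^`() s (oD s) in B0 vB Bb AE.
have ratB : rational beta.
  have rD x y : rational x -> rational y -> rational (x + y).
    by move=> [p ->] [q ->]; exists (p + q); rewrite rmorphD.
  have r0 : rational 0 by exists 0; rewrite rmorph0.
  have sQ : supp_in rational s by [].
  have sQ' : supp_in rational (oD s).
    by apply: supp_in_oD => //; exists (-1); rewrite rmorphN rmorph1.
  exact: (supp_in_ev r0 rD sQ sQ' Bb).
have [n bQ] := bisz_exists Q.
have [e e0 [ve vDe]] := bound_below s (oD s).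
pose K := e *+ (n.+2 + n.+2).
(* For [nu >= L + 1] the quadratic remainder starts beyond [beta + nu - 1], and [nu - mu + 1] is
   positive. *)
pose L := `|beta| + `|mu| + K + 1.
have K0 : 0 <= K by rewrite mulrn_wge0.
(* Including [beta] makes shifts by [beta - 1] preserve the lattice. Including the exponents up to
   [L + 1] pushes the first exponent outside the lattice past that bound. *)
have [d d0 dP] : exists2 d, (0 < d)%N &
    forall m, (m <= L + 1 /\ s m != 0) \/ m = beta -> lattice d m.
  apply: (@common_denominator ([set m | m <= L + 1 /\ s m != 0] `|` [set beta])).
    by rewrite finite_setU; split; [exact: oserP|exact: finite_set1].
  by move=> m [[_ /ratS]|->].
exists d => //.
pose t := restr (lattice d) s; pose z := s - t.
have zE m : z m = if m \in lattice d then 0 else s m.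
  by rewrite ocoefB coef_restr; case: ifP; rewrite ?subrr ?subr0.
suff z0 : z = 0.
  move=> m sm; apply: contrapT => nG.
  have := zE m; rewrite z0 ocoef0 memNset// => /esym/eqP.
  by rewrite (negPf sm).
apply/eqP; apply: contrapT => /negP/lead_exists[nu znu vz].
have nuG : ~ lattice d nu.
  by move=> G; move: znu; rewrite zE mem_set// eqxx.
have nuL : L + 1 <= nu.
  have snu : s nu != 0 by move: znu; rewrite zE memNset.
  rewrite leNgt; apply/negP => lt; apply: nuG; apply: dP; left; split=> //; exact: ltW.
have nb := ler_norm beta; have nm := ler_norm mu.
have nm0 := normr_ge0 mu; have nb0 := normr_ge0 beta.
have vz' : vge z (nu - 1) by apply: vgeW vz; lra.
have nu1 : 0 <= nu - 1 by rewrite /L in nuL; lra.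
have := taylor2 e0 nu1 bQ ve vDe (vgeN vz') (vgeN (vge_oD vz)).
rewrite -oDN -oDD -/A -/B eQ add0r.
have -> : s - z = t by rewrite /z opprB addrC subrK.
move=> /(_ (beta + nu - 1)); rewrite -/K => H.
have {H} : (ev Q t (oD t) - (A * - z + B * oD (- z))) (beta + nu - 1) = 0.
  by apply: H; rewrite /L in nuL; lra.
(* [ev Q t (oD t)] is supported in the lattice, so at this exponent the linear part must vanish by
   itself. *)
have Gbn : ~ lattice d (beta + nu - 1).
  move=> G; apply: nuG; have -> : nu = (beta + nu - 1) - (beta - 1) by ring.
  apply: latticeB => //; apply: latticeB; last exact: lattice1.
  by apply: dP; right.
have -> : ev Q t (oD t) - (A * - z + B * oD (- z)) =
  ev Q t (oD t) + (A * z + B * oD z) by rewrite oDN; ring.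
have tG : supp_in (lattice d) t.
  by move=> m; rewrite coef_restr; case: ifP; rewrite ?eqxx// => /set_mem.
rewrite ocoefD.
have -> : ev Q t (oD t) (beta + nu - 1) = 0.
  apply/eqP; apply: contrapT => /negP H; apply: Gbn.
  apply: (supp_in_ev (@lattice0 d) (@latticeD d) tG _ H).
  apply: supp_in_oD => //; first exact: latticeD.
  exact/latticeN/lattice1.
rewrite add0r ocoefD.
have -> : (A * z) (beta + nu - 1) = A (beta - 1) * z nu.
  by rewrite -(ocoefM_lead vA vz); congr ((A * z) _); ring.
have -> : (B * oD z) (beta + nu - 1) = B beta * (nu%:C * z nu).
  by rewrite -coef_oDB -(ocoefM_lead vB (vge_oD vz)); congr ((B * oD z) _); ring.
(* The indicial factor appears; it is nonzero by the choice of [L]. *)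
have -> : A (beta - 1) * z nu + B beta * (nu%:C * z nu) =
   (nu - mu + 1)%:C * (B beta * z nu).
  by rewrite AE !(rmorphD, rmorphN) /= ?rmorph1; ring.
move=> /eqP; rewrite !mulf_eq0 (negPf Bb) (negPf znu) !orbF.
rewrite -(rmorph0 (real_complex R)) (inj_eq (@complexI R)) => /eqP.
by rewrite /L in nuL; lra.
Qed.

Lemma is_puiseux_oC (c : C) : puiseux_with 1 (oC c).
Proof.
split=> // m; rewrite coef_mono; case: (m =P 0) => [->|_]; rewrite ?eqxx// => _.
by exists 0; rewrite mul0r.
Qed.

Theorem omega_solution_puiseux (P : {poly {poly C}}) s : P != 0 ->
  is_solution P s -> is_puiseux s.
Proof.
move=> P0 /is_solutionE sol.
have [[c ->]|nc] := pselect (exists c, s = oC c).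
  by exists 1%N; exact: is_puiseux_oC.
have {}nc c : s <> oC c by move=> e; apply: nc; exists c.
have [Q eQ B0] := separant_exists P0 sol nc.
have [d d0 dP] := bounded_denominators nc eQ B0.
by exists d; split.
Qed.

End Rationality.

(** * Convergence of Puiseux solutions *)

Section Convergence.
Variable R : realType.
Local Notation C := R[i].
Import numFieldNormedType.Exports.

Lemma cvg_complex (u : nat -> C) :
  cvgn (fun n => complex.Re (u n)) -> cvgn (fun n => complex.Im (u n)) ->
  cvg (u @ \oo).
Proof.
move=> /cvg_ex[/= a ua] /cvg_ex[/= b ub].
apply: (cvgP (a +i* b)).
apply: (proj2 (@cvgrPdist_lt _ (R[i])^o _ _ _ u _)) => e e0.
have [eR e0R] : e = (complex.Re e)%:C /\ 0 < complex.Re e.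
  by move: e0; rewrite ltcE /= => /andP[/eqP ie re]; split=> //; case: e ie re => x y /= ->.
near=> n.
apply: (@le_lt_trans _ _ (`|a - complex.Re (u n)| + `|b - complex.Im (u n)|)%:C).
  rewrite normc_def lecR; case: (u n) => x y /=.
  set p := a - x; set q := b - y.
  rewrite -[leRHS]ger0_norm ?addr_ge0// -sqrtr_sqr ler_wsqrtr//.
  rewrite -(real_normK (num_real p)) -(real_normK (num_real q)).
  by have := normr_ge0 p; have := normr_ge0 q; nra.
rewrite eR ltcR.
have -> : complex.Re e = complex.Re e / 2 + complex.Re e / 2 by field.
apply: ltrD; near: n.
- by move/cvgrPdist_lt: ua; apply; rewrite divr_gt0.
- by move/cvgrPdist_lt: ub; apply; rewrite divr_gt0.
Unshelve. all: by end_near.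
Qed.

Lemma real_part_of_pos (x : C) : 0 < x -> x = (complex.Re x)%:C /\ 0 < complex.Re x.
Proof.
by rewrite ltcE /= => /andP[/eqP ie re]; split=> //; case: x ie re => a b /= ->.
Qed.

(** Domination by the geometric series of ratio [|t| / rho]. The comparison is made over the reals,
    on real and imaginary parts. *)
Lemma cvg_power_series (u : nat -> C) (rho M t : C) : 0 < rho ->
  (forall k, `|u k| * rho ^+ k <= M) -> `|t| < rho ->
  cvg ((fun N : nat => \sum_(0 <= k < N) u k * t ^+ k) @ \oo).
Proof.
move=> rho0 uM tr.
pose z := complex.Re (`|t| / rho); pose m := complex.Re M.
have zE : `|t| / rho = z%:C.
  have [t0|t0] := eqVneq t 0; first by rewrite /z t0 normr0 mul0r.
  have p : 0 < `|t| / rho by rewrite divr_gt0// normr_gt0.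
  exact: (real_part_of_pos p).1.
have z0 : 0 <= z by rewrite -lecR -zE divr_ge0// ltW.
have z1 : `|z| < 1.
  by rewrite ger0_norm// -ltcR -zE ltr_pdivrMr// mul1r.
have M0 : 0 <= M by apply: le_trans (uM 0%N); rewrite mulr_ge0// exprn_ge0// ltW.
have mE : M = m%:C.
  by move: M0; rewrite /m le_eqVlt => /orP[/eqP<-//|/real_part_of_pos[]].
have m0 : 0 <= m by rewrite -lecR -mE.
have bnd k : `|u k * t ^+ k| <= (geometric m z k)%:C.
  rewrite /geometric /= normrM normrX.
  have -> : `|t| = rho * z%:C by rewrite -zE mulrC divfK// gt_eqF.
  rewrite exprMn mulrA rmorphM rmorphXn /= -mE ler_wpM2r ?exprn_ge0// lecR//.
have cvg_part (f : C -> R) : {morph f : x y / x + y} -> f 0 = 0 ->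
    (forall w, (`|f w|)%:C <= `|w|) ->
    cvgn (fun N => f (\sum_(0 <= k < N) u k * t ^+ k)).
  move=> fD f0 fn.
  have -> : (fun N => f (\sum_(0 <= k < N) u k * t ^+ k)) =
            series (fun k => f (u k * t ^+ k)).
    by apply/funext => N; rewrite /series /= (big_morph f fD f0).
  apply: normed_cvg; apply: (@series_le_cvg _ _ (geometric m z)).
  - by move=> n; exact: normr_ge0.
  - by move=> n; rewrite /geometric /= mulr_ge0// exprn_ge0.
  - by move=> n; rewrite -lecR; apply: le_trans (fn _) (bnd n).
  - exact: is_cvg_geometric_series.
apply: cvg_complex; apply: cvg_part => //; try by move=> [? ?] [? ?].
- by move=> w; exact: normc_ge_Re.
(* Up to sign, the imaginary part of [w] is the real part of [i w]. *)
- move=> w; have := normc_ge_Re (w * 'i%C); rewrite normrM ReiNIm normrN.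
  by rewrite [ `|'i%C|]normc_def /= expr0n add0r expr1n sqrtr1 mulr1.
Qed.

End Convergence.

(** * Weighted norms of truncated power series in [x^(1/d)] *)

Section Majorant.
Variable R : realType.
Local Notation C := R[i].
Variable d : nat.
Hypothesis d0 : (0 < d)%N.
Implicit Types (a b z q h : omega R).

Definition nlat : set R := [set m | exists k : nat, m = k%:R / d%:R].

Lemma dR_gt0 : 0 < d%:R :> R. Proof. by rewrite ltr0n. Qed.
Lemma dR_neq0 : d%:R != 0 :> R. Proof. by rewrite gt_eqF// dR_gt0. Qed.

Lemma nlat0 : nlat 0. Proof. by exists 0%N; rewrite mul0r. Qed.
Lemma nlatD x y : nlat x -> nlat y -> nlat (x + y).
Proof. by move=> [k ->] [l ->]; exists (k + l)%N; rewrite natrD mulrDl. Qed.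

Lemma nlat_lattice x : lattice d x -> 0 <= x -> nlat x.
Proof.
move=> [k ->]; rewrite pmulr_lge0 ?invr_gt0 ?dR_gt0// ler0z.
by case: k => // k _; exists k; rewrite pmulrn.
Qed.

Definition cf a (k : nat) : C := a (k%:R / d%:R).

Lemma cfM a b k : supp_in nlat a -> supp_in nlat b ->
  cf (a * b) k = \sum_(i < k.+1) cf a i * cf b (k - i)%N.
Proof.
move=> sa sb; rewrite /cf ocoefM.
have inj : injective (fun i : nat => i%:R / d%:R : R).
  by move=> i j /(mulIf (invr_neq0 dR_neq0))/eqP; rewrite eqr_nat => /eqP.
rewrite (@gmulE _ _ _ _ ((fun i : nat => i%:R / d%:R) @` `I_k.+1)); last first.
  move=> m /sa[i ->] /sb[j e]; exists i => //=.
  have : (k%:R - i%:R) / d%:R = j%:R / d%:R :> R by rewrite mulrBl.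
  move=> /(mulIf (invr_neq0 dR_neq0)) => e'.
  by rewrite ltnS -(ler_nat R) -subr_ge0 e' ler0n.
rewrite fsbig_image; last by move=> i j _ _; exact: inj.
rewrite -fsbig_ord; apply: eq_bigr => i _.
by rewrite natrB ?mulrBl// -ltnS.
Qed.

Variable rho : C.
Hypotheses (rho0 : 0 < rho) (rho1 : rho <= 1).

(** Truncation keeps this weighted norm finite before any convergence is known. *)
Definition nrm N a : C := \sum_(k < N) `|cf a k| * rho ^+ k.

Lemma nrm_term_ge0 a k : 0 <= `|cf a k| * rho ^+ k.
Proof. by rewrite mulr_ge0// exprn_ge0// ltW. Qed.
Lemma nrm_ge0 N a : 0 <= nrm N a.
Proof. by apply: sumr_ge0 => k _; exact: nrm_term_ge0. Qed.

Lemma nrmD N a b : nrm N (a + b) <= nrm N a + nrm N b.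
Proof.
rewrite /nrm -big_split; apply: ler_sum => k _.
by rewrite /= -mulrDl ler_wpM2r ?exprn_ge0 ?(ltW rho0) ?ler_normD.
Qed.

Lemma nrm_le N N' a : (N <= N')%N -> nrm N a <= nrm N' a.
Proof.
move=> le; rewrite /nrm -(subnKC le) big_split_ord /= lerDl.
by apply: sumr_ge0 => k _; exact: nrm_term_ge0.
Qed.

Lemma triangle_sum (u v : nat -> C) N :
  \sum_(k < N) \sum_(i < k.+1) u i * v (k - i)%N =
  \sum_(i < N) u i * \sum_(j < N - i) v j.
Proof.
elim: N => [|N IH]; first by rewrite !big_ord0.
rewrite big_ord_recr /= IH [RHS]big_ord_recr /= subSnn big_ord1.
rewrite big_ord_recr /= subnn addrA; congr (_ + _).
rewrite -big_split; apply: eq_bigr => i _ /=.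
by rewrite subSn 1?ltnW// big_ord_recr /= mulrDr.
Qed.

(** In absolute values, the truncated Cauchy product is part of the product of the truncations. *)
Lemma nrmM N a b : supp_in nlat a -> supp_in nlat b ->
  nrm N (a * b) <= nrm N a * nrm N b.
Proof.
move=> sa sb.
pose u k := `|cf a k| * rho ^+ k; pose v k := `|cf b k| * rho ^+ k.
apply: (@le_trans _ _ (\sum_(k < N) \sum_(i < k.+1) u i * v (k - i)%N)).
  apply: ler_sum => k _; rewrite cfM//.
  apply: (@le_trans _ _ ((\sum_(i < k.+1) `|cf a i * cf b (k - i)%N|) * rho ^+ k)).
    by rewrite ler_wpM2r ?exprn_ge0 ?(ltW rho0) ?ler_norm_sum.
  rewrite mulr_suml; apply: ler_sum => i _; rewrite /u /v normrM.
  have -> : rho ^+ k = rho ^+ i * rho ^+ (k - i)%N by rewrite -exprD subnKC// -ltnS.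
  by rewrite mulrACA.
rewrite triangle_sum /nrm mulr_suml; apply: ler_sum => i _.
apply: ler_wpM2l; first exact: nrm_term_ge0.
by apply: (@nrm_le (N - i) N b); exact: leq_subr.
Qed.

Lemma nrm1 N : nrm N 1 <= 1.
Proof.
case: N => [|N]; first by rewrite /nrm big_ord0.
rewrite /nrm big_ord_recl big1 => [|k _].
  by rewrite addr0 expr0 mulr1 /cf mul0r ocoef1 eqxx normr1.
by rewrite /cf ocoef1 mulf_eq0 invr_eq0 !pnatr_eq0 (gtn_eqF d0) /= normr0 mul0r.
Qed.

Lemma nrmX_le1 N a i : supp_in nlat a -> nrm N a <= 1 -> nrm N (a ^+ i) <= 1.
Proof.
move=> sa na; elim: i => [|i IH]; first by rewrite expr0 nrm1.
rewrite exprS; apply: le_trans (nrmM _ _ _) _ => //.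
  by apply: supp_inX => //; [exact: nlat0|exact: nlatD].
by rewrite mulr_ile1// nrm_ge0.
Qed.

(** A factor [x^(1/d)] gains [rho] and lets [N] terms control [N + 1]: this drives the induction in
    [majorant]. *)
Lemma nrm_shift N a : nrm N.+1 (mono 1 d%:R^-1 * a) = `|a (- d%:R^-1)| + rho * nrm N a.
Proof.
rewrite /nrm big_ord_recl expr0 mulr1; congr (_ + _).
  by rewrite /cf coef_monoM mul1r mul0r sub0r.
rewrite mulr_sumr; apply: eq_bigr => k _.
rewrite exprS mulrCA; congr (_ * (_ * _)).
rewrite /cf coef_monoM mul1r /=; congr (`| a _ |).
by rewrite /bump /= add1n -natr1 mulrDl mul1r addrK.
Qed.

End Majorant.

(** * The majorant argument *)

Section PuiseuxConvergence.
Variable R : realType.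
Local Notation C := R[i].
Implicit Types (a b z q s : omega R) (Q : {poly {poly C}}).

(** Together with [in_Omega] this means finite support: generalized polynomials. *)
Definition bdd a := exists M, forall m, M < m -> a m = 0.

Lemma bddD a b : bdd a -> bdd b -> bdd (a + b).
Proof.
move=> [M aM] [N bN]; exists (Num.max M N) => m; rewrite gt_max => /andP[Mm Nm].
by rewrite ocoefD aM// bN// addr0.
Qed.
Lemma bddM a b : bdd a -> bdd b -> bdd (a * b).
Proof.
move=> [M aM] [N bN]; exists (M + N) => m MNm.
rewrite ocoefM gmulT fsbig1// => k _.
have [Mk|kM] := ltP M k; first by rewrite aM// mul0r.
by rewrite bN ?mulr0//; lra.
Qed.
Lemma bdd_mono c mu : bdd (mono c mu : omega R).
Proof. by exists mu => m mum; rewrite coef_mono gt_eqF. Qed.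
Lemma bddX a n : bdd a -> bdd (a ^+ n).
Proof.
move=> ba; elim: n => [|n IH]; first by rewrite expr0; exact: bdd_mono.
by rewrite exprS; exact: bddM.
Qed.
Lemma bdd_sum (I : Type) (r : seq I) (T : pred I) (F : I -> omega R) :
  (forall i, T i -> bdd (F i)) -> bdd (\sum_(i <- r | T i) F i).
Proof.
move=> bF; apply: (big_ind bdd) => //; first by exists 0.
by move=> a b; exact: bddD.
Qed.
Lemma bdd_ev Q a b : bdd a -> bdd b -> bdd (ev Q a b).
Proof.
move=> ba bb; have [n bQ] := bisz_exists Q; rewrite (ev_sum _ _ bQ).
apply: bdd_sum => j _; apply: bdd_sum => i _.
apply: bddM; first exact: bdd_mono.
by apply: bddM; exact: bddX.
Qed.

Variable d : nat.
Hypothesis d0 : (0 < d)%N.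

(** Only finitely many coefficients count, and [rho <= 1] lets one bound serve all radii, so that
    [rho] can be chosen after the bound. *)
Lemma nrm_bdd a : bdd a -> exists2 S : C, 0 <= S &
  forall rho N, 0 < rho -> rho <= 1 -> nrm d rho N a <= S.
Proof.
move=> [M aM]; pose K := Num.bound (`|M| * d%:R).
exists (\sum_(k < K) `|cf d a k|); first by apply: sumr_ge0.
move=> rho N rho0 rho1.
apply: le_trans (nrm_le d rho0 a (leq_addl K N)) _.
rewrite /nrm big_split_ord /= [X in _ + X]big1 ?addr0.
  apply: ler_sum => k _; rewrite ler_piMr// exprn_ile1// ltW//.
move=> k _; rewrite /cf aM ?normr0 ?mul0r//.
apply: le_lt_trans (ler_norm _) _.
rewrite ltr_pdivlMr ?dR_gt0//.
have : `|M| * d%:R < K%:R by apply: archi_boundP; rewrite mulr_ge0.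
move=> /lt_le_trans; apply; rewrite ler_nat leq_addr//.
Qed.

(* Both [z] and [q] are majorised coefficientwise by [E], so no derivative is
   lost, and the factor [x^(1/d)] in every coefficient [h i j] turns the
   estimate into an induction on the number of terms of the partial sums. *)
Lemma majorant n (h : nat -> nat -> omega R) z q (C0 : C) : 0 <= C0 ->
  supp_in (nlat d) z -> supp_in (nlat d) q ->
  (forall i j, supp_in (nlat d) (mono 1 (- d%:R^-1) * h i j)) ->
  (forall i j, bdd (h i j)) ->
  let E := \sum_(j < n) \sum_(i < n) h i j * z ^+ i * q ^+ j in
  (forall k, `|cf d z k| <= C0 * `|cf d E k|) ->
  (forall k, `|cf d q k| <= C0 * `|cf d E k|) ->
  exists rho : C, [/\ 0 < rho, rho <= 1 & forall k, `|cf d z k| * rho ^+ k <= 1].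
Proof.
move=> C00 sz sq sh bh E zE qE.
pose h' i j := mono 1 (- d%:R^-1) * h i j.
have hE i j : h i j = mono 1 d%:R^-1 * h' i j.
  by rewrite /h' -[in X in mono 1 X * _](opprK d%:R^-1) monoK.
have bh' i j : bdd (h' i j) by apply: bddM; [exact: bdd_mono|exact: bh].
pose S i j := sval (cid2 (nrm_bdd (bh' i j))).
have S0 i j : 0 <= S i j by rewrite /S; case: cid2.
have SP i j rho N : 0 < rho -> rho <= 1 -> nrm d rho N (h' i j) <= S i j.
  by rewrite /S; case: cid2 => /= ? ? H ? ?; exact: H.
pose St := \sum_(j < n) \sum_(i < n) S i j.
have St0 : 0 <= St by apply: sumr_ge0 => j _; apply: sumr_ge0.
have den0 : 0 < 1 + C0 * St by rewrite ltr_wpDr// mulr_ge0.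
(* Makes [C0 * rho * St] at most 1, which closes the induction [key]. *)
pose rho := (1 + C0 * St)^-1.
have rho0 : 0 < rho by rewrite invr_gt0.
have rho1 : rho <= 1 by rewrite invf_le1// lerDl mulr_ge0.
have rhoS : C0 * (rho * St) <= 1.
  rewrite mulrCA /rho mulrC ler_pdivrMr// mul1r lerDr//.
have nrm_scale N a : (forall k, `|cf d a k| <= C0 * `|cf d E k|) ->
    nrm d rho N a <= C0 * nrm d rho N E.
  move=> aE; rewrite /nrm mulr_sumr; apply: ler_sum => k _.
  by rewrite mulrA ler_wpM2r// exprn_ge0// ltW.
have nl0 := @nlat0 R d; have nlD := @nlatD R d.
have key N : nrm d rho N z <= 1 /\ nrm d rho N q <= 1.
  elim: N => [|N [nz nq]]; first by rewrite /nrm !big_ord0.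
  suff nE : nrm d rho N.+1 E <= rho * St.
    by split; apply: le_trans (nrm_scale _ _ _) _ => //;
      apply: le_trans rhoS; rewrite ler_wpM2l.
  have nsum (I : finType) (F : I -> omega R) (B : I -> C) :
      (forall i, nrm d rho N.+1 (F i) <= B i) ->
      nrm d rho N.+1 (\sum_i F i) <= \sum_i B i.
    move=> FB; apply: (big_ind2 (fun a x => nrm d rho N.+1 a <= x)) => //.
      by rewrite /nrm big1// => k _; rewrite /cf ocoef0 normr0 mul0r.
    by move=> a x b y ax by_; apply: le_trans (nrmD _ rho0 _ _ _) (lerD ax by_).
  rewrite /St mulr_sumr; apply: (nsum _) => j; rewrite mulr_sumr; apply: (nsum _) => i.
  have sw : supp_in (nlat d) (z ^+ i * q ^+ j).
    by apply: supp_inM => //; apply: supp_inX.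
  rewrite -mulrA hE -mulrA nrm_shift.
  (* The stray coefficient of [nrm_shift] vanishes, since the product has no negative exponent. *)
  have -> : (h' i j * (z ^+ i * q ^+ j)) (- d%:R^-1) = 0.
    apply/eqP; apply: contrapT => /negP /(supp_inM nlD (sh i j) sw) [k e].
    have : 0 <= - d%:R^-1 :> R by rewrite e divr_ge0.
    by rewrite oppr_ge0 invr_le0 leNgt ltr0n d0.
  rewrite normr0 add0r ler_wpM2l ?(ltW rho0)//.
  apply: le_trans (nrmM d0 rho0 N (sh i j) sw) _.
  have sw1 : nrm d rho N (z ^+ i * q ^+ j) <= 1.
    apply: le_trans (nrmM d0 rho0 N _ _) _; [exact: supp_inX|exact: supp_inX|].
    by rewrite mulr_ile1 ?nrm_ge0// nrmX_le1.
  apply: le_trans (ler_wpM2l (nrm_ge0 _ rho0 _ _) sw1) _.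
  by rewrite mulr1; exact: SP.
exists rho; split=> // k; apply: le_trans (key k.+1).1.
by rewrite /nrm big_ord_recr /= lerDr; apply: nrm_ge0.
Qed.

(** Applied to the partial derivatives of [Q]: replacing a solution by a long truncation changes
    them only at high order. *)
Lemma taylor1 Q a b h k n (e L : R) : 0 <= e -> 0 <= L -> bisz n.+2 Q ->
  vge a (- e) -> vge b (- e) -> vge h L -> vge k L ->
  vge (ev Q (a + h) (b + k) - ev Q a b) (- (e *+ (n.+2 + n.+2)) + L).
Proof.
move=> e0 L0 bQ va vb vh vk.
have := taylor2 e0 L0 bQ va vb vh vk.
set X := ev Q (a + h) (b + k); set Y := ev Q a b.
set A := ev _ a b; set B := ev _ a b => v2.
have -> : X - Y = (X - (Y + A * h + B * k)) + (A * h + B * k) by ring.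
apply: vgeD; first by apply: vgeW v2; rewrite lerD2l lerDl.
have vA : vge A (- (e *+ (n.+2 + n.+2))).
  by apply: vge_ev => //; rewrite -hasse10; exact: bisz_hasse.
have vB : vge B (- (e *+ (n.+2 + n.+2))).
  by apply: vge_ev => //; rewrite -hasse01; exact: bisz_hasse.
by apply: vgeD; exact: vgeM.
Qed.

Lemma lattice_nat n : lattice d (n%:R : R).
Proof.
elim: n => [|n IH]; first exact: lattice0.
by rewrite -natr1; apply: latticeD => //; exact: lattice1.
Qed.

Lemma lattice_mulrn (x : R) n : lattice d x -> lattice d (x *+ n).
Proof.
move=> lx; elim: n => [|n IH]; first exact: lattice0.
by rewrite mulrS; exact: latticeD.
Qed.

(** A positive element of [(1/d) Z] is at least [1/d], so a factor [x^(1/d)] can be taken out. *)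
Lemma supp_in_shift a : supp_in (lattice d) a -> (forall m, m <= 0 -> a m = 0) ->
  supp_in (nlat d) (mono 1 (- d%:R^-1) * a).
Proof.
move=> sa pa m; rewrite coef_monoM mul1r opprK => am.
have [k ek] := sa _ am.
have : 0 < m + d%:R^-1 by rewrite ltNge; apply: contra am => /pa ->.
rewrite ek pmulr_lgt0 ?invr_gt0 ?dR_gt0// ltr0z.
case: k ek => // -[//|k] ek _; exists k.
rewrite -(addrK d%:R^-1 m) ek -pmulrn -natr1 mulrDl mul1r addrK//.
Qed.

End PuiseuxConvergence.

(** * Reduction of the tail equation to a majorisable form *)

Section PuiseuxSolutionConverges.
Variable R : realType.
Local Notation C := R[i].
Implicit Types (a b z q s : omega R) (Q : {poly {poly C}}).

Definition ispos a := forall m : R, m <= 0 -> a m = 0.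

Lemma isposM a b : ispos a -> vge b 0 -> ispos (b * a).
Proof.
move=> pa vb m m0; rewrite ocoefM gmulT fsbig1// => k _.
have [k0|k0] := ltP k 0; first by rewrite vb// mul0r.
by rewrite pa ?mulr0//; lra.
Qed.

Lemma ispos_vge a : ispos a -> vge a 0.
Proof. by move=> pa m m0; apply: pa; exact: ltW. Qed.

Lemma ispos_sum (I : Type) (r : seq I) (T : pred I) (F : I -> omega R) :
  (forall i, T i -> ispos (F i)) -> ispos (\sum_(i <- r | T i) F i).
Proof.
move=> pF; apply: (big_ind ispos) => // a b pa pb m m0.
by rewrite ocoefD pa// pb// addr0.
Qed.

Lemma sum_split00 (F : nat -> nat -> omega R) n :
  \sum_(j < n.+1) \sum_(i < n.+1) F i j =
  F 0%N 0%N + (\sum_(i < n) F i.+1 0%N + \sum_(j < n) \sum_(i < n.+1) F i j.+1).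
Proof. by rewrite big_ord_recl [in X in X + _]big_ord_recl addrA. Qed.

(* Write [s = T + x^K z] with [T] a truncation of [s], and [s' = T' + x^(K-1) q].
   For [K] large, dividing the Taylor expansion of [Q (s, s') = 0] at [(T, T')]
   by its leading power of [x] gives [a0 z + b0 q + E = 0], where [E] is a
   polynomial in [z], [q] whose coefficients all vanish at [x = 0], and where
   [a0 z + b0 q] dominates both [z] and [q] coefficientwise. *)
Lemma puiseux_coef_bound (d : nat) Q s : (0 < d)%N -> supp_in (lattice d) s ->
  (forall c, s <> oC c) -> ev Q s (oD s) = 0 -> ev Q^`() s (oD s) != 0 ->
  exists rho M : C, [/\ 0 < rho, rho <= 1 &
    forall k, `|cf d s k| * rho ^+ k <= M].
Proof.
move=> d0 sd nc eQ B0.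
have [mu [beta /= [_ _ [vB Bb] [vA AE]]]] := linearization nc eQ B0.
set A := ev (map_poly deriv Q) s (oD s) in vA AE.
set B := ev Q^`() s (oD s) in B0 vB Bb AE.
have l0 := @lattice0 R d; have lD := @latticeD R d.
have l1 : lattice d (-1 : R) by exact/latticeN/lattice1.
have lbeta : lattice d beta.
  by apply: (supp_in_ev l0 lD sd _ Bb); exact: supp_in_oD.
have [n bQ] := bisz_exists Q.
have [e e0 [ve vDe]] := bound_below s (oD s).
pose Kc := e *+ (n.+2 + n.+2).
have Kc0 : 0 <= Kc by rewrite mulrn_wge0.
(* Large enough that terms of degree at least 2 in [z], [q] have positive order, that [T] and [s]
   give the same leading parts of [A] and [B], and that [1 <= m + K <= 2 (m + K + 1 - mu)] for
   [m >= 0]. *)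
have [K KP] : exists K : nat, `|beta| + 2 * `|mu| + Kc + 3 < K%:R.
  exists (Num.bound (`|beta| + 2 * `|mu| + Kc + 3)); apply: archi_boundP.
  by have := normr_ge0 beta; have := normr_ge0 mu; lra.
have := ler_norm beta; have := ler_norm (- beta); rewrite normrN => nb1 nb2.
have nm := ler_norm mu; have nm0 := normr_ge0 mu; have nb0 := normr_ge0 beta.
pose U : set R := [set m | m <= K%:R].
pose T := restr U s; pose r := s - T.
have memU m : (m \in U) = (m <= K%:R) by apply/idP/idP; rewrite inE.
have TE m : T m = if m <= K%:R then s m else 0 by rewrite coef_restr memU.
have rE m : r m = if m <= K%:R then 0 else s m.
  by rewrite ocoefB TE; case: ifP; rewrite ?subrr ?subr0.
have sTr : s = T + r by rewrite /r addrC subrK.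
pose z := mono 1 (- K%:R) * r.
pose q := mono 1 (1 - K%:R) * oD r.
have zE m : z m = r (m + K%:R) by rewrite coef_monoM mul1r opprK.
have qE m : q m = (m + K%:R)%:C * z m.
  rewrite coef_monoM mul1r coef_oD zE.
  by have -> : m - (1 - K%:R) + 1 = m + K%:R by ring.
have rz : r = mono 1 K%:R * z.
  by rewrite /z -[in X in mono 1 X * _](opprK K%:R) monoK.
have rq : oD r = mono 1 (K%:R - 1) * q.
  by rewrite /q -[K%:R - 1]opprK opprB monoK.
have pz : ispos z.
  by move=> m m0; rewrite zE rE; case: ifP => // /negP[]; lra.
have pq : ispos q by move=> m m0; rewrite qE pz// mulr0.
have vr : vge r K%:R by move=> m mK; rewrite rE ltW.
have vDr : vge (oD r) (K%:R - 1) by exact: vge_oD.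
have vr1 : vge r (K%:R - 1) by apply: vgeW vr; lra.
have K1 : 0 <= K%:R - 1 :> R by lra.
have vT : vge T (- e) by move=> m me; rewrite TE ve// if_same.
have vDT : vge (oD T) (- e).
  move=> m me; rewrite coef_oD TE; case: ifP; rewrite ?mulr0// => _.
  by rewrite -coef_oD vDe.
have sT : supp_in (lattice d) T.
  by move=> m; rewrite TE; case: ifP; rewrite ?eqxx// => _ /sd.
have sDT : supp_in (lattice d) (oD T) by exact: supp_in_oD.
have bT : bdd T by exists K%:R => m Km; rewrite TE leNgt Km.
have bDT : bdd (oD T).
  by exists K%:R => m Km; rewrite coef_oD TE leNgt (_ : K%:R < m + 1) ?mulr0//; lra.
pose g i j := ev (hasse i j Q) T (oD T).
(* The exponent left from [x^(K i)] and [x^((K - 1) j)] after division by [x^(K - 1 + beta)], the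
   least possible order of the linear part. *)
pose ex i j : R := K%:R *+ i + (K%:R - 1) *+ j - (K%:R - 1) - beta.
pose f i j := mono 1 (ex i j) * g i j.
have fsum : \sum_(j < n.+2) \sum_(i < n.+2) f i j * z ^+ i * q ^+ j = 0.
  transitivity (mono 1 (- (K%:R - 1) - beta) * ev Q (T + r) (oD T + oD r)).
    rewrite (taylor _ _ _ _ bQ) mulr_sumr; apply: eq_bigr => j _.
    rewrite mulr_sumr; apply: eq_bigr => i _.
    rewrite rq {1}rz !exprMn !monoX /f -/(g i j).
    have -> : mono 1 (ex i j) = mono 1 (- (K%:R - 1) - beta) * mono 1 (K%:R *+ i)
       * mono 1 ((K%:R - 1) *+ j) :> omega R.
      by rewrite !mono_mul !mulr1; congr mono; rewrite /ex; ring.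
    ring.
  by rewrite -oDD -sTr eQ mulr0.
pose b0 := B beta; pose a0 := A (beta - 1).
have vg i j : vge (g i j) (- Kc) by apply: vge_ev => //; exact: bisz_hasse.
have vf2 i j : (1 < i + j)%N -> ispos (f i j).
  move=> ij m m0; rewrite coef_monoM vg ?mulr0//.
  have : (K%:R - 1) *+ 2 <= K%:R *+ i + (K%:R - 1) *+ j :> R.
    apply: (@le_trans _ _ ((K%:R - 1) *+ i + (K%:R - 1) *+ j)).
      by rewrite -mulrnDr ler_wpMn2l.
    by rewrite lerD2r ler_wMn2r//; lra.
  by rewrite mulr2n /ex; lra.
(* Up to exponent [0] this coefficient is unchanged when [T] is replaced by [s], so it shows the
   leading part of [A]. *)
have f10 m : m <= 0 -> f 1%N 0%N m = if m == 0 then a0 else 0.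
  move=> m0; rewrite coef_monoM mul1r /ex mulr1n mulr0n.
  have -> : m - (K%:R + 0 - (K%:R - 1) - beta) = m + (beta - 1) by ring.
  have := taylor1 e0 K1 _ vT vDT vr1 vDr (Q := map_poly deriv Q) (n := n).
  rewrite -hasse10 => /(_ (bisz_hasse 1 0 bQ)).
  rewrite -sTr -oDD -sTr -/Kc -/(g _ _) => /(_ (m + (beta - 1))) H.
  have {H} : (ev (hasse 1 0 Q) s (oD s) - g 1%N 0%N) (m + (beta - 1)) = 0.
    by apply: H; lra.
  rewrite hasse10 -/A ocoefB => /eqP; rewrite subr_eq0 => /eqP <-.
  case: eqVneq => [->|mn0]; first by rewrite add0r.
  by rewrite vA//; move: m0; rewrite le_eqVlt (negPf mn0) /=; lra.
have f01 m : m <= 0 -> f 0%N 1%N m = if m == 0 then b0 else 0.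
  move=> m0; rewrite coef_monoM mul1r /ex mulr1n mulr0n.
  have -> : m - (0 + (K%:R - 1) - (K%:R - 1) - beta) = m + beta by ring.
  have := taylor1 e0 K1 _ vT vDT vr1 vDr (Q := Q^`()) (n := n).
  rewrite -hasse01 => /(_ (bisz_hasse 0 1 bQ)).
  rewrite -sTr -oDD -sTr -/Kc -/(g _ _) => /(_ (m + beta)) H.
  have {H} : (ev (hasse 0 1 Q) s (oD s) - g 0%N 1%N) (m + beta) = 0.
    by apply: H; lra.
  rewrite hasse01 -/B ocoefB => /eqP; rewrite subr_eq0 => /eqP <-.
  case: eqVneq => [->|mn0]; first by rewrite add0r.
  by rewrite vB//; move: m0; rewrite le_eqVlt (negPf mn0) /=; lra.
have vf i j : (0 < i + j)%N -> vge (f i j) 0.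
  case: i j => [|[|i]] [|[|j]] // _; try by apply: ispos_vge; exact: vf2.
  - by move=> m m0; rewrite f01 ?ltW// lt_eqF.
  - by move=> m m0; rewrite f10 ?ltW// lt_eqF.
have posX i j : (0 < i + j)%N -> ispos (z ^+ i * q ^+ j).
  have vX a k : ispos a -> vge (a ^+ k) 0.
    by move=> /ispos_vge va; rewrite -(mul0rn R k); exact: vgeX.
  case: i => [|i] /=; last first.
    move=> _; rewrite exprS -mulrA mulrC; apply: isposM => //.
    by rewrite -[0]addr0; apply: vgeM; exact: vX.
  case: j => // j _; rewrite expr0 mul1r exprS mulrC; apply: isposM => //.
  exact: vX.
(* The residual [Q (T, T')] is not estimated directly: all other terms of [fsum] have positive
   order, hence so has this one. *)
have f00 : ispos (f 0%N 0%N).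
  move: fsum; rewrite (sum_split00 (fun i j => f i j * z ^+ i * q ^+ j)).
  rewrite !expr0 !mulr1 => /eqP; rewrite addr_eq0 => /eqP -> m m0.
  rewrite ocoefN ocoefD.
  have -> : (\sum_(i < n.+1) f i.+1 0%N * z ^+ i.+1 * 1) m = 0.
    move: m m0; apply: ispos_sum => i _; rewrite -(expr0 q).
    by rewrite -mulrA; apply: isposM; [exact: posX|exact: vf].
  rewrite add0r.
  have -> : (\sum_(j < n.+1) \sum_(i < n.+2) f i j.+1 * z ^+ i * q ^+ j.+1) m = 0.
    move: m m0; apply: ispos_sum => j _; apply: ispos_sum => i _.
    by rewrite -mulrA; apply: isposM; [apply: posX|apply: vf]; rewrite addnS.
  by rewrite oppr0.
(* The values at [x = 0] of the linear coefficients; subtracting them leaves every [h i j] of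
   positive order. *)
pose c i j : C := if (i, j) == (1, 0)%N then a0 else if (i, j) == (0, 1)%N then b0 else 0.
pose h i j := f i j - oC (c i j).
have hpos i j : ispos (h i j).
  move=> m m0; rewrite ocoefB coef_mono.
  case: i j => [|[|i]] [|[|j]];
    by [rewrite [c _ _]/= if_same subr0 f00 | rewrite [c _ _]/= if_same subr0 vf2
       |rewrite [c _ _]/= f01// subrr|rewrite [c _ _]/= f10// subrr].
have hlat i j : supp_in (lattice d) (h i j).
  apply: supp_inB; last exact: supp_in_oC.
  apply: supp_inM => //; last exact: supp_in_ev.
  apply: supp_in_mono; apply: latticeB => //.
  apply: latticeB; last by apply: latticeB; [exact: lattice_nat|exact: lattice1].
  apply: latticeD; apply: lattice_mulrn => //; first exact: lattice_nat.
  by apply: latticeB; [exact: lattice_nat|exact: lattice1].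
have bh i j : bdd (h i j).
  apply: bddD; first by apply: bddM; [exact: bdd_mono|exact: bdd_ev].
  by rewrite -rmorphN; exact: bdd_mono.
pose E := \sum_(j < n.+2) \sum_(i < n.+2) h i j * z ^+ i * q ^+ j.
have EE : E = - (oC a0 * z + oC b0 * q).
  have csum : \sum_(j < n.+2) \sum_(i < n.+2) oC (c i j) * z ^+ i * q ^+ j =
      oC a0 * z + oC b0 * q.
    rewrite (sum_split00 (fun i j => oC (c i j) * z ^+ i * q ^+ j)).
    rewrite [c 0%N 0%N]/= rmorph0 !mul0r add0r; congr (_ + _).
      rewrite big_ord_recl big1 ?addr0 => [|i _].
        by rewrite expr0 expr1 mulr1.
      by rewrite [c _ _]/= rmorph0 !mul0r.
    rewrite big_ord_recl [X in _ + X]big1 ?addr0 => [|j _]; last first.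
      by rewrite big1// => -[[|[|i]] ?] _; rewrite [c _ _]/= rmorph0 !mul0r.
    rewrite big_ord_recl [X in _ + X]big1 ?addr0 => [|[[|i] ?] _].
    - by rewrite expr0 expr1 mulr1.
    - by rewrite [c _ _]/= rmorph0 !mul0r.
    - by rewrite [c _ _]/= rmorph0 !mul0r.
  rewrite -csum; apply/eqP; rewrite -addr_eq0; apply/eqP.
  rewrite -[RHS]fsum /E -big_split; apply: eq_bigr => j _ /=.
  rewrite -big_split; apply: eq_bigr => i _ /=.
  by rewrite /h; ring.
have snl a : supp_in (lattice d) a -> ispos a -> supp_in (nlat d) a.
  move=> sa pa m am; apply: (nlat_lattice d0); first exact: sa.
  by rewrite leNgt; apply/negP => /ltW/pa/eqP; rewrite (negPf am).
have sr : supp_in (lattice d) r by exact: supp_inB.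
have sz : supp_in (lattice d) z.
  by apply: supp_inM => //; apply: supp_in_mono; apply: latticeN; exact: lattice_nat.
have sq : supp_in (lattice d) q.
  by move=> m; rewrite qE mulf_eq0 negb_or => /andP[_ /sz].
(* The indicial factor grows with [m] like the factor [m + K] in [q], so [E] bounds [q] and not only
   [z]. *)
have Em m : E m = - (b0 * (m + K%:R + 1 - mu)%:C * z m).
  have a0E : a0 = (1 - mu)%:C * b0 by exact: AE.
  rewrite EE ocoefN ocoefD (coef_oCM a0) (coef_oCM b0) qE a0E.
  have -> : (m + K%:R + 1 - mu)%:C = (1 - mu)%:C + (m + K%:R)%:C.
    by rewrite -rmorphD; congr (_%:C); ring.
  ring.
have b00 : 0 < `|b0| by rewrite normr_gt0.
have normE m : 0 <= m -> `|E m| = `|b0| * (m + K%:R + 1 - mu)%:C * `|z m|.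
  move=> m0; rewrite Em normrN !normrM; congr (_ * _ * _).
  by rewrite ger0_norm// -[0]/(0%:C) lecR; lra.
have C00 : 0 <= 2 / `|b0| :> C by rewrite divr_ge0.
have kd0 k : 0 <= k%:R / d%:R :> R by rewrite divr_ge0.
have q_le k : `|cf d q k| <= 2 / `|b0| * `|cf d E k|.
  rewrite /cf normE// qE normrM.
  set m := k%:R / d%:R; have m0 : 0 <= m by exact: kd0.
  rewrite !mulrA divfK ?gt_eqF//.
  apply: ler_wpM2r => //; rewrite ger0_norm; last by rewrite -[0]/(0%:C) lecR; lra.
  by rewrite mulr_natl -rmorphMn /= lecR mulr2n; lra.
have z_le k : `|cf d z k| <= 2 / `|b0| * `|cf d E k|.
  apply: le_trans (q_le k); rewrite /cf qE normrM ler_peMl//.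
  have m0 := kd0 k.
  rewrite ger0_norm; last by rewrite -[0]/(0%:C) lecR; lra.
  by rewrite -[1 : C]/(1%:C) lecR; lra.
have [rho [rho0 rho1 rhoz]] := majorant d0 C00 (snl _ sz pz) (snl _ sq pq)
  (fun i j => supp_in_shift d0 (hlat i j) (hpos i j)) bh z_le q_le.
pose M0 := \sum_(k < (K * d).+1) `|cf d s k|.
have M00 : 0 <= M0 by apply: sumr_ge0.
exists rho, (1 + M0); split=> // k.
have [kK|Kk] := leqP k (K * d).
  apply: (@le_trans _ _ M0); last by rewrite lerDr.
  rewrite /M0 (bigD1 (Ordinal (kK : k < (K * d).+1)%N)) //=.
  apply: ler_wpDr; first exact: sumr_ge0.
  by rewrite ler_piMr// exprn_ile1// ltW.
apply: (@le_trans _ _ 1); last by rewrite lerDl.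
have kE : k%:R / d%:R = (k - K * d)%N%:R / d%:R + K%:R :> R.
  by rewrite natrB 1?ltnW// natrM; field; exact: dR_neq0.
have -> : cf d s k = cf d z (k - K * d)%N.
  rewrite /cf zE -kE rE leNgt (_ : K%:R < _)//.
  by rewrite ltr_pdivlMr ?dR_gt0// -natrM ltr_nat.
apply: le_trans (rhoz (k - K * d)%N).
rewrite ler_wpM2l// ler_wiXn2l ?leq_subr// ltW//.
Qed.

Theorem puiseux_solution_converges (P : {poly {poly C}}) s : P != 0 ->
  is_puiseux s -> is_solution P s -> convergent_puiseux s.
Proof.
move=> P0 [d [d0 sd]] /is_solutionE sol; exists d; split=> //.
suff [rho [M [rho0 rho1 bnd]]] : exists rho M : C, [/\ 0 < rho, rho <= 1 &
    forall k, `|cf d s k| * rho ^+ k <= M].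
  have [rhoE rhoR] := real_part_of_pos rho0.
  exists (complex.Re rho); split=> // t; rewrite -rhoE => tr.
  exact: cvg_power_series rho0 bnd tr.
have [[c ->]|nc] := pselect (exists c, s = oC c).
  exists 1, `|c|; split=> // k; rewrite expr1n mulr1 /cf coef_mono.
  by case: ifP; rewrite ?normr0.
have {}nc c : s <> oC c by move=> e; apply: nc; exists c.
have [Q eQ B0] := separant_exists P0 sol nc.
exact: puiseux_coef_bound nc eQ B0.
Qed.

End PuiseuxSolutionConverges.

(** * Newton-Puiseux and existence of solutions *)

Section NewtonPuiseux.
Variable R : realType.
Local Notation C := R[i].
Implicit Types (a b y z : omega R) (f g H : {poly omega R}).

(** Completeness: the coefficient at [m] is constant along the sequence once [k eps > m], and the
    limit reads it there. *)
Lemma omega_limit (u : nat -> omega R) (eps : R) : 0 < eps ->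
  (forall k, vge (u k.+1 - u k) (k%:R * eps)) ->
  exists y, forall k, vge (y - u k) (k%:R * eps).
Proof.
move=> eps0 uP.
have mono_u k l : vge (u (k + l)%N - u k) (k%:R * eps).
  elim: l => [|l IH]; first by rewrite addn0 subrr.
  have -> : u (k + l.+1)%N - u k = (u (k + l).+1 - u (k + l)%N) + (u (k + l)%N - u k).
    by rewrite addnS; ring.
  apply: vgeD => //; apply: vgeW (uP _).
  by rewrite ler_wpM2r ?(ltW eps0)// ler_nat leq_addr.
have agree k l m : m < k%:R * eps -> m < l%:R * eps -> u k m = u l m.
  wlog kl : k l / (k <= l)%N.
    by move=> W mk ml; have [kl|/ltnW lk] := leqP k l; [exact: W|symmetry; exact: W].
  move=> mk _; apply/esym/eqP; rewrite -subr_eq0 -ocoefB -(subnKC kl).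
  by rewrite mono_u.
pose K (m : R) := Num.bound (`|m| / eps).
have KP m : m < (K m)%:R * eps.
  rewrite -ltr_pdivrMr//; apply: (@le_lt_trans _ _ (`|m| / eps)).
    by rewrite ler_wpM2r ?invr_ge0 ?(ltW eps0)// ler_norm.
  by apply: archi_boundP; rewrite divr_ge0// ltW.
have oy : in_Omega (fun m => u (K m) m).
  move=> M; apply: sub_finite_set (oserP (u (K M)) M) => m /= [mM].
  by rewrite (agree (K m) (K M) m (KP m) (le_lt_trans mM (KP M))); split.
exists (MkOmega oy) => k m mk.
by rewrite ocoefB /= (agree (K m) k m (KP m) mk) subrr.
Qed.

Lemma limit_coef (u : nat -> omega R) (eps : R) y : 0 < eps ->
  (forall k, vge (y - u k) (k%:R * eps)) -> forall m, exists k, y m = u k m.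
Proof.
move=> eps0 uy m; exists (Num.bound (`|m| / eps)).
apply/eqP; rewrite -subr_eq0 -ocoefB uy// -ltr_pdivrMr//.
apply: (@le_lt_trans _ _ (`|m| / eps)).
  by rewrite ler_wpM2r ?invr_ge0 ?(ltW eps0)// ler_norm.
by apply: archi_boundP; rewrite divr_ge0// ltW.
Qed.

Lemma vge_eq0_nat a (eps : R) : 0 < eps -> (forall k : nat, vge a (k%:R * eps)) -> a = 0.
Proof.
move=> eps0 va; apply: omegaP => m.
have [|k ->] := @limit_coef (fun=> 0) eps a eps0 _ m; last by [].
by move=> k; rewrite subr0.
Qed.

(** The maximal ideal of the local ring [C[[x^(1/d)]]]. *)
Definition maxid (d : nat) y := supp_in (nlat d) y /\ y 0 = 0.

Lemma maxid_vge d y : (0 < d)%N -> maxid d y -> vge y d%:R^-1.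
Proof.
move=> d0 [sy y0] m md; apply/eqP; apply: contraTT md => ym; rewrite -leNgt.
have [k e] := sy _ ym; rewrite e -[leLHS]mul1r ler_wpM2r ?invr_ge0//.
rewrite ler1n lt0n; apply: contraNneq ym => k0.
by rewrite e k0 mul0r y0.
Qed.

Lemma nlat_vge d y : supp_in (nlat d) y -> vge y 0.
Proof.
move=> sy m m0; apply/eqP; apply: contraTT m0 => /sy[k ->].
by rewrite -leNgt divr_ge0.
Qed.

(** The map [y |-> y - F y / c] contracts the maximal ideal, each step gaining [1/d]. [F] is an
    arbitrary map because it stands for a polynomial in [hensel_poly] and for a power series in
    [psubst_inverse]. *)
Lemma hensel d (F : omega R -> omega R) (c : C) : (0 < d)%N -> c != 0 ->
  (forall y, maxid d y -> supp_in (nlat d) (F y)) -> F 0 0 = 0 ->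
  (forall y y' N, maxid d y -> maxid d y' -> vge (y - y') (N%:R * d%:R^-1) ->
     vge (F y - F y' - oC c * (y - y')) (N.+1%:R * d%:R^-1)) ->
  exists2 y, maxid d y & F y = 0.
Proof.
move=> d0 c0 sF F00 cF; pose Phi y := y - oC c^-1 * F y.
have nl0 := nlat0 R d; have nlD := @nlatD R d.
have m0 : maxid d 0 by split=> //; exact: supp_in0.
have dd0 : 0 < d%:R^-1 :> R by rewrite invr_gt0 ltr0n.
have mPhi y : maxid d y -> maxid d (Phi y).
  move=> my; have [sy y0] := my; split.
    by apply: supp_inB => //; apply: supp_inM => //; [exact: supp_in_oC|exact: sF].
  rewrite ocoefB coef_oCM y0 sub0r.
  have : (F y - F 0 - oC c * (y - 0)) 0 = 0.
    by apply: (cF _ _ 0%N) => //; rewrite ?mul0r ?mul1r// subr0; exact: nlat_vge sy.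
  by rewrite !ocoefB coef_oCM subr0 y0 mulr0 F00 !subr0 => ->; rewrite mulr0 oppr0.
have cPhi y y' N : maxid d y -> maxid d y' -> vge (y - y') (N%:R * d%:R^-1) ->
    vge (Phi y - Phi y') (N.+1%:R * d%:R^-1).
  move=> my my' v.
  have -> : Phi y - Phi y' = - (oC c^-1 * (F y - F y' - oC c * (y - y'))).
    have e : oC c^-1 * oC c = 1 by rewrite -rmorphM mulVf// rmorph1.
    have -> : - (oC c^-1 * (F y - F y' - oC c * (y - y'))) =
      (oC c^-1 * oC c) * (y - y') - oC c^-1 * (F y - F y') by ring.
    by rewrite e /Phi; ring.
  apply: vgeN; rewrite -[X in vge _ X]add0r; apply: vgeM; first exact: vge_oC.
  exact: cF.
pose u k := iter k Phi 0.
have mu k : maxid d (u k) by elim: k => //= k; exact: mPhi.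
have uP k : vge (u k.+1 - u k) (k%:R * d%:R^-1).
  elim: k => [|k IH]; last exact: (cPhi _ _ _ (mu k.+1) (mu k) IH).
  by rewrite mul0r subr0; exact: (nlat_vge (mu 1%N).1).
have [y yP] := omega_limit dd0 uP.
have yc := limit_coef dd0 yP.
have my : maxid d y.
  split=> [m|]; last by have [k ->] := yc 0; exact: (mu k).2.
  by have [k ->] := yc m; exact: (mu k).1.
exists y => //.
have PhiE : y - Phi y = 0.
  apply: (vge_eq0_nat dd0) => k.
  have -> : y - Phi y = (y - u k.+1) - (Phi y - Phi (u k)) by rewrite /=; ring.
  have kS : k%:R * d%:R^-1 <= k.+1%:R * d%:R^-1 :> R by rewrite ler_wpM2r ?(ltW dd0)// ler_nat.
  apply: vgeB; apply: (vgeW kS); first exact: yP.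
  exact: (cPhi _ _ _ my (mu k) (yP k)).
have : oC c * (y - Phi y) = F y.
  have -> : oC c * (y - Phi y) = (oC c * oC c^-1) * F y by rewrite /Phi; ring.
  by rewrite -rmorphM mulfV// rmorph1 mul1r.
by rewrite PhiE mulr0.
Qed.

Lemma vge_subX y y' (M e : R) i : 0 <= e -> vge y e -> vge y' e -> vge (y - y') M ->
  vge (y ^+ i.+1 - y' ^+ i.+1) (M + e *+ i).
Proof.
move=> e0 vy vy' v; rewrite subrXX; apply: vgeM => //.
apply: vge_sum => j _.
have -> : e *+ i = e *+ (i.+1.-1 - j) + e *+ j.
  by rewrite -mulrnDr subnK// -ltnS.
by apply: vgeM; rewrite -?subn1 ?subSS ?subn0 ?subnS; apply: vgeX.
Qed.

Lemma hensel_poly d f : (0 < d)%N -> (forall i, supp_in (nlat d) f`_i) ->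
  f`_0 0 = 0 -> f`_1 0 != 0 -> exists2 y, maxid d y & f.[y] = 0.
Proof.
move=> d0 sf f0 f1; apply: (hensel d0 f1).
- move=> y [sy _]; apply: supp_in_horner => //; [exact: nlat0|exact: nlatD].
- by rewrite horner_coef0.
move=> y y' N my my' v.
have vy := maxid_vge d0 my; have vy' := maxid_vge d0 my'.
have dd0 : 0 <= d%:R^-1 :> R by rewrite invr_ge0.
have sz : (size f <= (size f).+2)%N by rewrite leqW.
rewrite !(horner_coef_wide _ sz) -sumrB big_ord_recl big_ord_recl /= !expr0 !expr1.
rewrite subrr add0r addrAC -mulrBr -mulrBl.
have NS : N.+1%:R * d%:R^-1 = d%:R^-1 + N%:R * d%:R^-1 :> R.
  by rewrite -natr1; ring.
apply: vgeD.
  rewrite NS; apply: vgeM => //; apply: maxid_vge => //; split.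
    apply: supp_inB => //; apply: supp_in_oC; exact: nlat0.
  by rewrite ocoefB coef_mono eqxx subrr.
apply: vge_sum => i _; rewrite -mulrBr -[X in vge _ X]add0r.
apply: vgeM; first exact: nlat_vge (sf _).
apply: (vgeW _ (@vge_subX y y' _ _ (bump 0 i) dd0 vy vy' v)).
rewrite NS addrC lerD2l /bump /= mulrS lerDl mulrn_wge0//.
Qed.

(** Reduction at [x = 0]: additive everywhere, but multiplicative only on series without negative
    exponents. *)
Definition res a : C := a 0.
Lemma res_is_zmod_morphism : zmod_morphism res.
Proof. by move=> a b; rewrite /res ocoefB. Qed.
HB.instance Definition _ := GRing.isZmodMorphism.Build (omega R) C res
  res_is_zmod_morphism.

Lemma resM d a b : supp_in (nlat d) a -> supp_in (nlat d) b ->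
  res (a * b) = res a * res b.
Proof.
move=> /nlat_vge va /nlat_vge vb.
by rewrite /res -[in LHS](addr0 (0 : R)) ocoefM_lead.
Qed.

Lemma resX d a n : supp_in (nlat d) a -> res (a ^+ n) = res a ^+ n.
Proof.
move=> sa; elim: n => [|n IH]; first by rewrite /res !expr0 ocoef1 eqxx.
rewrite !exprS -IH; apply: (resM sa); apply: supp_inX => //; [exact: nlat0|exact: nlatD].
Qed.

Lemma res_horner d f a : (forall i, supp_in (nlat d) f`_i) -> supp_in (nlat d) a ->
  res f.[a] = (map_poly res f).[res a].
Proof.
move=> sf sa; rewrite horner_coef (@horner_coef_wide _ (size f)); last exact: size_poly.
rewrite raddf_sum; apply: eq_bigr => i _; rewrite coef_map /= -(resX _ sa).
apply: (@resM d) => //; apply: supp_inX => //; [exact: nlat0|exact: nlatD].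
Qed.

Lemma map_res_nderivn f i : map_poly res f^`N(i) = (map_poly res f)^`N(i).
Proof.
by apply/polyP => j; rewrite coef_map !coef_nderivn coef_map /= raddfMn.
Qed.

Lemma supp_in_nderivn d f i j : (forall i, supp_in (nlat d) f`_i) ->
  supp_in (nlat d) f^`N(i)`_j.
Proof.
move=> sf; rewrite coef_nderivn; elim: 'C(_, _) => [|k IH].
  by rewrite mulr0n; exact: supp_in0.
by rewrite mulrS; exact: supp_inD.
Qed.

(** The Taylor shift [f (a + X)]. *)
Definition shiftp f a : {poly omega R} := \poly_(i < size f) f^`N(i).[a].

Lemma coef_shiftp f a i : (shiftp f a)`_i = f^`N(i).[a].
Proof.
rewrite coef_poly; case: ltnP => // fi.
suff -> : f^`N(i) = 0 by rewrite horner0.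
apply/polyP => j; rewrite coef_nderivn coef0 nth_default ?mul0rn//.
exact: leq_trans fi (leq_addr _ _).
Qed.

Lemma horner_shiftp f a z : (shiftp f a).[z] = f.[a + z].
Proof. by rewrite horner_poly nderiv_taylor//; exact: mulrC. Qed.

Lemma supp_in_shiftp d f a i : (forall i, supp_in (nlat d) f`_i) ->
  supp_in (nlat d) a -> supp_in (nlat d) (shiftp f a)`_i.
Proof.
move=> sf sa; rewrite coef_shiftp; apply: supp_in_horner => //.
- exact: nlat0.
- exact: nlatD.
- by move=> j; exact: supp_in_nderivn.
Qed.

Lemma res_shiftp d f a i : (forall i, supp_in (nlat d) f`_i) -> supp_in (nlat d) a ->
  res (shiftp f a)`_i = (map_poly res f)^`N(i).[res a].
Proof.
move=> sf sa; rewrite coef_shiftp (@res_horner d)// ?map_res_nderivn// => j.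
exact: supp_in_nderivn.
Qed.

(** The residue of [f] has at [0] a zero of multiplicity exactly [m]. The denominators are
    quantified inside because they change along the recursion. *)
Definition has_root_of_mult (m : nat) := forall d f, (0 < d)%N ->
  (forall i, supp_in (nlat d) f`_i) -> (forall i, (i < m)%N -> res f`_i = 0) ->
  res f`_m != 0 -> exists e y, [/\ (0 < e)%N, supp_in (nlat e) y & f.[y] = 0].

Lemma nlat_dvd d e (x : R) : (0 < d)%N -> (0 < e)%N -> nlat d x -> nlat (d * e) x.
Proof.
move=> d0 e0 [k ->]; exists (k * e)%N; rewrite !natrM; field.
by rewrite !pnatr_eq0 -!lt0n d0 e0.
Qed.

(** Translate [c] to the origin: the multiplicity there is the least order of a divided derivative
    of the residue that is nonzero at [c], hence at most [k]. *)
Lemma root_from_residue d f (c : C) k : (0 < d)%N ->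
  (forall i, supp_in (nlat d) f`_i) -> (map_poly res f).[c] = 0 ->
  (map_poly res f)^`N(k).[c] != 0 ->
  (forall m, (0 < m <= k)%N -> has_root_of_mult m) ->
  exists e y, [/\ (0 < e)%N, supp_in (nlat e) y & f.[y] = 0].
Proof.
move=> d0 sf rc rk NP.
have ex : exists k, (map_poly res f)^`N(k).[c] != 0 by exists k.
have scc : supp_in (nlat d) (oC c) by apply: supp_in_oC; exact: nlat0.
have rcc : res (oC c) = c by rewrite /res coef_mono eqxx.
case: (ex_minnP ex) => m rm mmin.
have m0 : (0 < m)%N.
  by rewrite lt0n; apply: contraNneq rm => ->; rewrite nderivn0 rc.
have [|//||||e [z [e0 sz ez]]] := NP m _ d (shiftp f (oC c)).
- by rewrite m0 mmin.
- by move=> i; exact: supp_in_shiftp.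
- move=> i im; rewrite (res_shiftp _ sf scc) rcc; apply/eqP.
  by apply: contraTT im => /mmin; rewrite -leqNgt.
- by rewrite (res_shiftp _ sf scc) rcc.
exists e, (oC c + z); split=> //; last by rewrite -horner_shiftp.
by apply: supp_inD => //; apply: supp_in_oC; exact: nlat0.
Qed.

(* Newton-Puiseux by induction on the multiplicity [m] of the residue at [0]:
   Hensel's lemma gives a root of the [(m-1)]-st derivative, and moving it to
   the origin kills the coefficient of degree [m-1], so that on the first edge
   of the Newton polygon no root of the residue has multiplicity [m]. *)
Lemma newton_puiseux m : (0 < m)%N -> has_root_of_mult m.
Proof.
have [n] := ubnP m; elim: n m => // n IHn m mn m0 d f d0 sf fm f_m.
have m1 : m.-1.+1 = m by rewrite prednK.
(* The residue of this derivative has a simple zero at [0]: its linear coefficient is [m] times the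
   residue of [f_m]. *)
have [a ma fa] : exists2 a, maxid d a & f^`N(m.-1).[a] = 0.
  apply: (@hensel_poly d) => //.
  - by move=> i; exact: supp_in_nderivn.
  - by rewrite coef_nderivn addn0 binn mulr1n; apply: fm; rewrite m1.
  - rewrite coef_nderivn addn1 m1 -{2}m1 binSn m1 -/(res (f`_m *+ m)) raddfMn.
    by rewrite mulrn_eq0 negb_or -lt0n m0.
have [sa a0] := ma; pose g i := f^`N(i).[a].
have gE i : (shiftp f a)`_i = g i by exact: coef_shiftp.
have sg i : supp_in (nlat d) (g i) by rewrite -gE; exact: supp_in_shiftp.
have rg i : res (g i) = res f`_i.
  rewrite -gE (res_shiftp _ sf sa) [res a]a0 horner_coef0 coef_nderivn addn0 binn.
  by rewrite coef_map.
(* With no edge to follow, [a] is itself a root. *)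
have [all0|] := pselect (forall i, (i < m)%N -> g i = 0).
  by exists d, a; split=> //; have := all0 _ m0; rewrite /g nderivn0.
move=> /existsNP[j0 /not_implyP[j0m /eqP gj0]].
have /choice [om omP] : forall i, exists w, g i != 0 -> g i w != 0 /\ vge (g i) w.
  move=> i; have [->|/lead_exists[w gw vw]] := eqVneq (g i) 0; first by exists 0.
  by exists w.
(* Slopes of the Newton polygon seen from its vertex at [m]; [nu] is the smallest, attained at
   [i0]. *)
pose A := (fun i => om i / (m - i)%:R) @` [set i | (i < m)%N /\ g i != 0].
have [||nu [i0 [i0m gi0] nuE] numin] := @finite_set_min R A.
- apply: finite_image; apply: sub_finite_set (finite_II m) => i [].
  by rewrite /= => im _.
- by exists (om j0 / (m - j0)%:R); exists j0.
have mi i : (i < m)%N -> 0 < (m - i)%:R :> R by rewrite ltr0n subn_gt0.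
have o_ge i : (i < m)%N -> g i != 0 -> nu * (m - i)%:R <= om i.
  by move=> im gi; rewrite -ler_pdivlMr ?mi//; apply: numin; exists i.
have oi0 : om i0 = nu * (m - i0)%:R by rewrite -nuE divfK// gt_eqF// mi.
have [goi0 voi0] := omP _ gi0.
have [k0 k0E] := sg _ _ goi0.
have k00 : (0 < k0)%N.
  rewrite lt0n; apply: contraNneq goi0 => k00; rewrite k0E k00 mul0r.
  by rewrite -/(res (g i0)) rg fm.
pose e := (d * (m - i0))%N.
have e0 : (0 < e)%N by rewrite muln_gt0 d0 subn_gt0.
have mi0 : (m - i0)%:R != 0 :> R by rewrite gt_eqF ?mi.
have dR0 : d%:R != 0 :> R by rewrite pnatr_eq0 -lt0n.
have nu_e : nu = k0%:R / e%:R.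
  rewrite -nuE k0E /e natrM; field; by rewrite dR0 mi0.
have nu0 : 0 < nu by rewrite nu_e divr_gt0// ltr0n.
have nl0 := nlat0 R e; have nlD := @nlatD R e.
have lnu : lattice e nu by exists k0; rewrite nu_e -pmulrn.
have sge i : supp_in (nlat e) (g i).
  by move=> x /sg; apply: nlat_dvd => //; rewrite subn_gt0.
have lg i : supp_in (lattice e) (g i).
  by move=> x /sge [k ->]; exists k; rewrite -pmulrn.
(* Coefficients of the shifted polynomial at [x^nu X], divided by [x^(nu m)]. *)
pose h i := mono 1 (nu * (i%:R - m%:R)) * g i.
have vh i : vge (h i) 0.
  have [im|mi'] := ltnP i m.
    have [gi|gi] := eqVneq (g i) 0; first by rewrite /h gi mulr0.
    have [_ vg] := omP _ gi.
    apply: (vgeW _ (@vge_monoM R 1 (nu * (i%:R - m%:R)) _ _ vg)).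
    by have := o_ge _ im gi; rewrite natrB 1?ltnW//; lra.
  apply: (vgeW _ (@vge_monoM R 1 (nu * (i%:R - m%:R)) _ _ (nlat_vge (sg i)))).
  by rewrite addr0 mulr_ge0 ?(ltW nu0)// subr_ge0 ler_nat.
have sh i : supp_in (nlat e) (h i).
  move=> x hx; apply: nlat_lattice => //; last first.
    by rewrite leNgt; apply/negP => /(vh i) /eqP; rewrite (negPf hx).
  move: hx; rewrite coef_monoM mul1r => /lg lx.
  have -> : x = (x - nu * (i%:R - m%:R)) + (nu *+ i - nu *+ m) by ring.
  apply: latticeD => //; apply: latticeB; exact: lattice_mulrn.
have hm : res (h m) = res f`_m by rewrite /h subrr mulr0 mul1r rg.
have hm1 : h m.-1 = 0 by rewrite /h /g fa mulr0.
have hi0 : res (h i0) != 0.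
  rewrite /res coef_monoM mul1r sub0r; congr (_ != _) : goi0; congr (g _ _).
  by rewrite oi0 natrB 1?ltnW//; ring.
have hgt i : (m < i)%N -> res (h i) = 0.
  move=> mi'; rewrite /res coef_monoM (nlat_vge (sg i)) ?mulr0// sub0r oppr_lt0.
  by rewrite mulr_gt0// subr_gt0 ltr_nat.
have msz : (m < size f)%N.
  rewrite ltnNge; apply: contra f_m => szm.
  by rewrite nth_default// raddf0.
pose H := \poly_(i < size f) h i.
have HE i : H`_i = h i.
  rewrite coef_poly; case: ltnP => // fi.
  by rewrite /h -gE /shiftp coef_poly ltnNge fi /= mulr0.
have rH i : (map_poly res H)`_i = res (h i) by rewrite coef_map HE.
have szH : size (map_poly res H) = m.+1.
  apply/eqP; rewrite eqn_leq; apply/andP; split.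
    by apply/leq_sizeP => i mi'; rewrite rH hgt.
  by apply: contraNltn f_m => /leq_sizeP/(_ m (leqnn m)); rewrite rH hm => ->.
have [c rc] : exists c, root (map_poly res H) c.
  by apply/closed_rootP; rewrite szH eqSS -lt0n.
(* Otherwise the residue would be a multiple of [(X - c)^m]. Its zero coefficient at [m - 1] then
   gives [c = 0], against the nonzero coefficient at [i0]. *)
have [k km rk] : exists2 k, (k < m)%N & (map_poly res H)^`N(k).[c] != 0.
  apply: contrapT => no.
  have all0 k : (k < m)%N -> (map_poly res H)^`N(k).[c] = 0.
    by move=> km; apply/eqP; apply: contrapT => /negP nz; apply: no; exists k.
  have c0 : c = 0.
    have := all0 m.-1; rewrite m1 => /(_ (leqnn _)).
    rewrite (@horner_coef_wide _ 2); last first.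
      apply/leq_sizeP => -[|[|j]] // _; rewrite coef_nderivn.
      by rewrite nth_default ?mul0rn// szH -{1}m1 !addnS !ltnS leq_addr.
    rewrite !big_ord_recl big_ord0 /= !coef_nderivn addn0 addn1 m1 !rH hm1 raddf0.
    have bm : 'C(m, m.-1) = m by rewrite -{1}m1 binSn.
    rewrite mul0rn mul0r add0r addr0 expr1 bm => /eqP.
    by rewrite mulf_eq0 mulrn_eq0 -[m == 0%N]negbK -lt0n m0 hm (negPf f_m) => /eqP.
  have := all0 _ i0m; rewrite c0 horner_coef0 coef_nderivn addn0 binn mulr1n rH.
  by move/eqP; rewrite (negPf hi0).
have [e' [w [e'0 sw Hw]]] : exists e y, [/\ (0 < e)%N, supp_in (nlat e) y & H.[y] = 0].
  apply: (@root_from_residue e _ c k) => //.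
  - by move=> i; rewrite HE.
  - exact/eqP.
  - move=> m' /andP[m'0 m'k]; apply: IHn => //.
    by apply: leq_ltn_trans m'k _; apply: leq_trans km _.
exists (e * e')%N, (a + mono 1 nu * w); split; first by rewrite muln_gt0 e0.
- have nl0' := nlat0 R (e * e'); have nlD' := @nlatD R (e * e').
  apply: supp_inD => //.
    by move=> x /sa /(nlat_dvd d0 (_ : 0 < m - i0)%N); rewrite subn_gt0 i0m =>
      /(_ isT) /(nlat_dvd e0 e'0).
  apply: supp_inM => //; last first.
    by move=> x /sw; rewrite mulnC; exact: nlat_dvd.
  by apply: supp_in_mono; apply: nlat_dvd => //; exists k0.
rewrite -horner_shiftp horner_poly.
transitivity (mono 1 (nu * m%:R) * H.[w]); last by rewrite Hw mulr0.
rewrite horner_poly mulr_sumr; apply: eq_bigr => i _.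
rewrite -/(g i) exprMn monoX /h.
have -> : mono 1 (nu *+ i) = mono 1 (nu * m%:R) * mono 1 (nu * (i%:R - m%:R)) :> omega R.
  by rewrite mono_mul mulr1; congr mono; ring.
ring.
Qed.

End NewtonPuiseux.

(** * Substitution into power series and compositional inversion *)

Section Substitution.
Variable R : realType.
Local Notation C := R[i].
Implicit Types (a b u y z W : omega R) (f : {poly omega R}) (zeta eta : nat -> C).

Definition trunc K zeta : {poly C} := \poly_(k < K) zeta k.

Lemma ev0_trunc u K zeta : ev0 u (trunc K zeta) = \sum_(k < K) oC (zeta k) * u ^+ k.
Proof.
rewrite (@ev0_sum _ _ _ K) ?size_poly//; apply: eq_bigr => k _.
by rewrite coef_poly ltn_ord.
Qed.

(* [W] is the value at [u] of the power series with coefficients [zeta], where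
   [u] has order at least [1/N]. *)
Definition psubst (N : nat) zeta u W :=
  forall K : nat, vge (W - ev0 u (trunc K zeta)) (K%:R * N%:R^-1).

Variable N : nat.
Hypothesis N0 : (0 < N)%N.
Let iN0 : 0 < N%:R^-1 :> R. Proof. by rewrite invr_gt0 ltr0n. Qed.
Let iNN : N%:R * N%:R^-1 = 1 :> R. Proof. by rewrite divff// pnatr_eq0 -lt0n. Qed.

Lemma vge_expN u k : vge u N%:R^-1 -> vge (u ^+ k) (k%:R * N%:R^-1).
Proof. by move=> vu; rewrite mulr_natl; exact: vgeX. Qed.

Lemma vge_oCM c a M : vge a M -> vge (oC c * a) M.
Proof. by move=> va; rewrite -[M]add0r; apply: vgeM => //; exact: vge_oC. Qed.

Lemma psubst_exists zeta u : vge u N%:R^-1 -> exists W, psubst N zeta u W.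
Proof.
move=> vu; apply: omega_limit => // k.
rewrite !ev0_trunc big_ord_recr /= addrAC subrr add0r.
by apply: vge_oCM; exact: vge_expN.
Qed.

Lemma psubst_coef zeta u W : psubst N zeta u W ->
  forall m, exists K, W m = ev0 u (trunc K zeta) m.
Proof. exact: limit_coef. Qed.

Lemma vge_horner_sub f W W' M : (forall i, vge f`_i 0) -> vge W 0 -> vge W' 0 ->
  vge (W - W') M -> vge (f.[W] - f.[W']) M.
Proof.
move=> vf vW vW' v; rewrite !horner_coef -sumrB; apply: vge_sum => i _.
rewrite -mulrBr -[M]add0r; apply: vgeM => //; case: (nat_of_ord i) => [|k].
  by rewrite !expr0 subrr.
by rewrite -[M]addr0 -(mul0rn R k); exact: vge_subX.
Qed.

Lemma vge_ev0 u (p : {poly C}) : vge u 0 -> vge (ev0 u p) 0.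
Proof.
move=> vu; rewrite (ev0_sum _ (leqnn _)); apply: vge_sum => i _.
by apply: vge_oCM; rewrite -(mul0rn R i); exact: vgeX.
Qed.

Lemma vge_psubst0 zeta u W : psubst N zeta u W -> vge W 0.
Proof. by move=> /(_ 0%N); rewrite ev0_trunc big_ord0 subr0 mul0r. Qed.

Lemma coef_ev0_root d (p : {poly C}) k : (0 < d)%N ->
  ev0 (mono 1 d%:R^-1) p (k%:R * d%:R^-1) = p`_k.
Proof.
move=> d0; have dn : d%:R^-1 != 0 :> R by rewrite invr_neq0// pnatr_eq0 -lt0n.
rewrite (@ev0_sum _ _ _ (size p + k.+1)) ?leq_addr// ocoef_sum.
have kn : (k < size p + k.+1)%N by rewrite addnS ltnS leq_addl.
rewrite (bigD1 (Ordinal kn))// big1 => [|i ik].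
  by rewrite monoX coef_oCM coef_mono /= mulr_natl eqxx mulr1 addr0.
rewrite monoX coef_oCM coef_mono -[_ *+ i]mulr_natl; case: eqP => [e|_]; last by rewrite mulr0.
case/eqP: ik; apply: val_inj; apply/eqP.
by rewrite /= -(eqr_nat R) (mulIf dn e).
Qed.

(** Thus [z] is its own coefficient series evaluated at [x^(1/d)], the starting point for
    transporting relations to another [u]. *)
Lemma psubst_root d z : (0 < d)%N -> supp_in (nlat d) z ->
  psubst d (cf d z) (mono 1 d%:R^-1) z.
Proof.
move=> d0 sz K m mK; apply/eqP; rewrite ocoefB subr_eq0; apply/eqP.
have idgt0 : 0 < d%:R^-1 :> R by rewrite invr_gt0 ltr0n.
have [[k mE]|nm] := pselect (nlat d m).
  rewrite mE coef_ev0_root// coef_poly.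
  by move: mK; rewrite mE ltr_pM2r// ltr_nat => ->.
rewrite (_ : z m = 0); last by apply/eqP; apply: contrapT => /negP/sz.
apply/esym/eqP; apply: contrapT => /negP; move: nm; apply: contra_not.
apply: supp_in_ev0; [exact: nlat0|exact: nlatD|].
by apply: supp_in_mono; exists 1%N; rewrite mul1r.
Qed.

Definition coefpoly n (B : nat -> {poly C}) u : {poly omega R} :=
  \poly_(j < n) ev0 u (B j).

Lemma ev0_coefpoly n (B : nat -> {poly C}) u (q : {poly C}) :
  ev0 u (\sum_(j < n) B j * q ^+ j) = (coefpoly n B u).[ev0 u q].
Proof.
rewrite horner_poly rmorph_sum; apply: eq_bigr => j _.
by rewrite rmorphM rmorphXn.
Qed.

Lemma vge_coefpoly n (B : nat -> {poly C}) u i : vge u 0 -> vge (coefpoly n B u)`_i 0.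
Proof. by move=> vu; rewrite coef_poly; case: ifP => // _; exact: vge_ev0. Qed.

(* The identity holds formally in [C[[t]]], hence after substitution of [u]. *)
Lemma psubst_relation d n (B : nat -> {poly C}) z u W : (0 < d)%N ->
  supp_in (nlat d) z -> (coefpoly n B (mono 1 d%:R^-1)).[z] = 0 ->
  vge u N%:R^-1 -> psubst N (cf d z) u W -> (coefpoly n B u).[W] = 0.
Proof.
move=> d0 sz relz vu uW.
have idgt0 : 0 < d%:R^-1 :> R by rewrite invr_gt0 ltr0n.
apply: (vge_eq0_nat iN0) => K.
pose q := trunc K (cf d z); pose G := \sum_(j < n) B j * q ^+ j.
have vr : vge (mono 1 d%:R^-1 : omega R) 0.
  exact: (vgeW (ltW idgt0) (@vge_mono R 1 _)).
have vu0 : vge u 0 by apply: vgeW vu; exact: ltW.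
(* At [x^(1/d)] the truncated relation differs from the exact one only from order [K/d] on, so the
   polynomial [G] is divisible by [X^K]. *)
have G0 k : (k < K)%N -> G`_k = 0.
  move=> kK; rewrite -(coef_ev0_root G k d0) ev0_coefpoly.
  have := @vge_horner_sub (coefpoly n B (mono 1 d%:R^-1)) z (ev0 (mono 1 d%:R^-1) q)
    (K%:R * d%:R^-1) _ (nlat_vge sz) (vge_ev0 _ vr) (@psubst_root d z d0 sz K).
  rewrite relz => /(_ (fun i => vge_coefpoly _ _ _ vr)) /(_ (k%:R * d%:R^-1)).
  rewrite ltr_pM2r// ltr_nat => /(_ kK) /eqP.
  by rewrite ocoefB sub0r oppr_eq0 => /eqP.
have -> : (coefpoly n B u).[W] =
    ((coefpoly n B u).[W] - (coefpoly n B u).[ev0 u q]) + ev0 u G.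
  by rewrite ev0_coefpoly subrK.
apply: vgeD.
  apply: vge_horner_sub; [|exact: vge_psubst0 uW|exact: vge_ev0|exact: uW].
  by move=> i; exact: vge_coefpoly.
rewrite (ev0_sum _ (leqnn _)); apply: vge_sum => i _.
have [iK|Ki] := ltnP i K; first by rewrite G0// rmorph0 mul0r.
apply: vge_oCM; apply: (vgeW _ (@vge_expN u i vu)).
by rewrite ler_wpM2r ?(ltW iN0)// ler_nat.
Qed.

Lemma psubst_oD eta u W W1 : vge u N%:R^-1 -> psubst N eta u W ->
  psubst N (fun k => k.+1%:R * eta k.+1) u W1 -> oD W = W1 * oD u.
Proof.
move=> vu uW uW1; apply/eqP; rewrite -subr_eq0; apply/eqP.
(* Differentiation costs order [1 = N/N], which the [N] extra terms pay for. *)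
apply: (vge_eq0_nat iN0) => k; pose K := (k + N)%N.
have KE : k%:R * N%:R^-1 <= K.+1%:R * N%:R^-1 - 1 :> R.
  by rewrite -natr1 natrD !mulrDl iNN mul1r; have := iN0; lra.
apply: (vgeW KE).
have dE : (trunc K.+1 eta)^`() = trunc K (fun k => k.+1%:R * eta k.+1).
  apply/polyP => i; rewrite coef_deriv !coef_poly ltnS.
  by case: ifP; rewrite ?mul0rn// mulr_natl.
have -> : oD W - W1 * oD u = oD (W - ev0 u (trunc K.+1 eta)) -
    (W1 - ev0 u (trunc K (fun k => k.+1%:R * eta k.+1))) * oD u.
  rewrite oDB (derivation_ev0 u (trunc K.+1 eta) (derivation_oD R)) dE; ring.
apply: vgeB; first exact: vge_oD.
have -> : K.+1%:R * N%:R^-1 - 1 = K%:R * N%:R^-1 + (N%:R^-1 - 1) :> R.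
  by rewrite -natr1; ring.
by apply: vgeM => //; exact: vge_oD.
Qed.

(** Write [u = x^(1/N) (g0 + y)] with [g0^N = 1/eta_N]. The equation becomes one in [y] with linear
    coefficient [N eta_N g0^(N-1)], to which [hensel] applies. *)
Lemma psubst_inverse eta : (forall k, (k < N)%N -> eta k = 0) -> eta N != 0 ->
  exists2 u, maxid N u & psubst N eta u (mono 1 1).
Proof.
move=> eta0 etaN.
pose g0 : C := N.-root (eta N)^-1.
have g0N : eta N * g0 ^+ N = 1 by rewrite /g0 rootCK// divff.
have g00 : g0 != 0.
  by apply: contraPneq g0N => ->; rewrite expr0n eqn0Ngt N0 mulr0 => /esym/eqP; rewrite oner_eq0.
pose bb y := oC g0 + y; pose ux y := mono 1 N%:R^-1 * bb y.
have nl0 := nlat0 R N; have nlD := @nlatD R N.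
have sb y : maxid N y -> supp_in (nlat N) (bb y).
  by move=> [sy _]; apply: supp_inD => //; exact: supp_in_oC.
have su y : maxid N y -> supp_in (nlat N) (ux y).
  move=> my; apply: supp_inM => //; last exact: sb.
  by apply: supp_in_mono; exists 1%N; rewrite mul1r.
have vu y : maxid N y -> vge (ux y) N%:R^-1.
  move=> my; rewrite -[X in vge _ X]addr0; apply: vge_monoM.
  exact: nlat_vge (sb _ my).
have uX y k : ux y ^+ k = mono 1 (k%:R * N%:R^-1) * bb y ^+ k.
  by rewrite exprMn monoX mulr_natl.
have /choice[Fc FcP] : forall y, exists W, maxid N y -> psubst N eta (ux y) W.
  move=> y; have [my|nmy] := pselect (maxid N y); last by exists 0.
  by have [W uW] := psubst_exists eta (vu y my); exists W.
have vFc y : maxid N y -> vge (Fc y) 1.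
  move=> my; have := FcP y my N; rewrite iNN ev0_trunc big1 ?subr0// => k _.
  by rewrite eta0// rmorph0 mul0r.
pose F y := mono 1 (-1) * Fc y - 1.
have [||||y my Fy] := @hensel R N F (eta N * (g0 ^+ N.-1 *+ N)) N0.
- by rewrite mulf_neq0// mulrn_eq0 negb_or -lt0n N0 expf_neq0.
- move=> y my; apply: supp_inB => //; last exact: supp_in1.
  move=> m; rewrite coef_monoM mul1r opprK => Fm.
  have [K FK] := psubst_coef (FcP y my) (m + 1).
  have [k kE] : nlat N (m + 1).
    by move: Fm; rewrite FK; apply: supp_in_ev0 => //; exact: su.
  have m1 : 1 <= m + 1.
    by rewrite leNgt; apply/negP => /(vFc _ my)/eqP; rewrite (negPf Fm).
  have Nk : (N <= k)%N.
    rewrite -(ler_nat R) -(ler_pM2r iN0) iNN.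
    by move: m1; rewrite kE.
  exists (k - N)%N; rewrite natrB// mulrBl iNN -kE; ring.
- have m0 : maxid N (0 : omega R) by split=> //; exact: supp_in0.
  rewrite ocoefB coef_monoM mul1r opprK add0r ocoef1 eqxx.
  have := FcP 0 m0 N.+1 1; rewrite -natr1 mulrDl iNN mul1r ltrDl iN0 => /(_ isT).
  have -> : ev0 (ux 0) (trunc N.+1 eta) = oC (eta N) * ux 0 ^+ N.
    rewrite ev0_trunc big_ord_recr big1 /= ?add0r// => k _.
    by rewrite /= (eta0 _ (ltn_ord k)) rmorph0 mul0r.
  rewrite uX iNN ocoefB coef_oCM coef_monoM subrr mul1r /bb addr0 -rmorphXn /=.
  by rewrite eqxx g0N.
- move=> y y' M my my' v.
  (* After division by [x], the terms from [K] on have order at least [K/N - 1 = (M + 1)/N]. *)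
  pose K := (N + M.+1)%N.
  have bsub : bb y - bb y' = y - y' by rewrite /bb; ring.
  have vb y0 : maxid N y0 -> vge (bb y0) 0 by move=> /sb/nlat_vge.
  pose D k := bb y ^+ k - bb y' ^+ k.
  have vD k : vge (D k) (M%:R * N%:R^-1).
    rewrite /D; case: k => [|k]; first by rewrite !expr0 subrr.
    rewrite -[X in vge _ X]addr0 -(mul0rn R k); apply: vge_subX => //.
    - exact: vb.
    - exact: vb.
    - by rewrite bsub.
  have trE : mono 1 (-1) * (ev0 (ux y) (trunc K eta) - ev0 (ux y') (trunc K eta)) =
      oC (eta N) * D N + \sum_(i < M) oC (eta (N + i.+1)%N) *
         (mono 1 (i.+1%:R * N%:R^-1) * D (N + i.+1)%N).
    rewrite !ev0_trunc -sumrB /K big_split_ord /= big1 ?add0r => [|k _]; last first.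
      by rewrite eta0// rmorph0 !mul0r subrr.
    rewrite mulr_sumr big_ord_recl /= addn0; congr (_ + _).
      rewrite !uX iNN -mulrBr -mulrBr mulrCA; congr (_ * _).
      by rewrite mulrA mono_mul mul1r addNr mul1r.
    apply: eq_bigr => i _; rewrite !uX -mulrBr -mulrBr mulrCA; congr (_ * _).
    rewrite mulrA mono_mul mul1r; congr (mono 1 _ * _).
    by rewrite natrD mulrDl iNN addrA addNr add0r.
  have -> : F y - F y' - oC (eta N * (g0 ^+ N.-1 *+ N)) * (y - y') =
     mono 1 (-1) * ((Fc y - ev0 (ux y) (trunc K eta)) - (Fc y' - ev0 (ux y') (trunc K eta)))
     + (mono 1 (-1) * (ev0 (ux y) (trunc K eta) - ev0 (ux y') (trunc K eta))
       - oC (eta N * (g0 ^+ N.-1 *+ N)) * (y - y')) by rewrite /F; ring.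
  apply: vgeD.
    have -> : M.+1%:R * N%:R^-1 = - 1 + K%:R * N%:R^-1 :> R.
      by rewrite /K natrD mulrDl iNN addrA addNr add0r.
    by apply: vge_monoM; apply: vgeB; [exact: (FcP y my K)|exact: (FcP y' my' K)].
  rewrite trE addrAC; apply: vgeD; last first.
    apply: vge_sum => i _; apply: vge_oCM.
    apply: (vgeW _ (@vge_monoM R 1 (i.+1%:R * N%:R^-1) _ _ (vD _))).
    rewrite -mulrDl ler_wpM2r ?(ltW iN0)// -natrD ler_nat.
    by rewrite addSn ltnS leq_addl.
  (* The cofactor [S] of [y - y'] in the difference of [N]-th powers has residue [N g0^(N-1)], which
     cancels the linear coefficient. *)
  rewrite /D subrXX bsub.
  set S := \sum_(i < N) _.
  have -> : oC (eta N) * ((y - y') * S) - oC (eta N * (g0 ^+ N.-1 *+ N)) * (y - y') =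
    (oC (eta N) * S - oC (eta N * (g0 ^+ N.-1 *+ N))) * (y - y') by ring.
  have -> : M.+1%:R * N%:R^-1 = N%:R^-1 + M%:R * N%:R^-1 :> R by rewrite -natr1; ring.
  apply: vgeM => //; apply: maxid_vge => //.
  have sS : supp_in (nlat N) S.
    apply: supp_in_sum => i _; apply: supp_inM => //; apply: supp_inX => //.
      exact: (sb _ my).
    exact: (sb _ my').
  have sC (c : C) : supp_in (nlat N) (oC c) by exact: supp_in_oC.
  split; first by apply: supp_inB => //; exact: supp_inM.
  have rb y0 : maxid N y0 -> res (bb y0) = g0.
    by move=> [_ y00]; rewrite /res ocoefD coef_mono eqxx y00 addr0.
  rewrite ocoefB [(oC _ * S) 0](resM (sC _) sS) coef_mono eqxx.
  rewrite [res (oC _)]coef_mono eqxx /S raddf_sum.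
  rewrite (eq_bigr (fun=> g0 ^+ N.-1)) => [|i _].
    by rewrite sumr_const card_ord subrr.
  rewrite [LHS](@resM _ N); last 2 first.
  - by apply: supp_inX => //; exact: sb.
  - by apply: supp_inX => //; exact: sb.
  rewrite (resX _ (sb _ my)) (resX _ (sb _ my')) !rb// -exprD subnK//.
  by rewrite -ltnS prednK.
exists (ux y).
  split; first exact: su.
  by apply: vu => //; exact: iN0.
have -> : mono 1 1 = Fc y :> omega R.
  rewrite -[RHS](monoK (-1)) opprK; move/eqP: Fy; rewrite subr_eq0 => /eqP ->.
  by rewrite mulr1.
exact: FcP.
Qed.

End Substitution.

(** * Solutions with a prescribed value *)

Section Existence.
Variable R : realType.
Local Notation C := R[i].

Lemma ev0_comp (p q : {poly C}) (u : omega R) : ev0 u (p \Po q) = ev0 (ev0 u q) p.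
Proof. by rewrite /ev0 map_comp_poly horner_comp. Qed.

Lemma ev0_res (a : omega R) (p : {poly C}) d : supp_in (nlat d) a ->
  ev0 a p 0 = p.[a 0].
Proof.
move=> sa; rewrite -[LHS]/(res (ev0 a p)) /ev0 (@res_horner _ d)//.
  congr (_.[_]); apply/polyP => i; rewrite coef_map coef_map /=.
  by rewrite /res /= eqxx.
by move=> i; rewrite coef_map; apply: supp_in_oC; exact: nlat0.
Qed.

Theorem solution_exists (P : {poly {poly C}}) (c0 : C) : P != 0 -> (1 < size P)%N ->
  exists s : omega R, [/\ is_solution P s, (forall m, s m != 0 -> 0 <= m) & s 0 = c0].
Proof.
move=> P0 sP.
have [Pc|Pc] := eqVneq (P`_0).[c0] 0.
  exists (oC c0); split.
  - apply/is_solutionE; rewrite oD_oC /ev horner_coef0 coef_map /= /ev0.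
    by rewrite (horner_map (@oC R)) Pc rmorph0.
  - by move=> m; rewrite coef_mono; case: (m =P 0) => [->|]; rewrite ?eqxx.
  - by rewrite coef_mono eqxx.
pose n := (size P).-1.
have szP : size P = n.+1 by rewrite prednK// ltnW.
have n0 : (0 < n)%N by rewrite -ltnS -szP.
pose x1 : omega R := oC c0 + mono 1 1.
have sx1 : supp_in (nlat 1) x1.
  apply: supp_inD; first by apply: supp_in_oC; exact: nlat0.
  by apply: supp_in_mono; exists 1%N; rewrite divr1.
have x10 : x1 0 = c0.
  by rewrite ocoefD !coef_mono eqxx eq_sym oner_eq0 addr0.
have x1nc c : x1 <> oC c.
  move=> /(congr1 (fun a : omega R => a 1)); rewrite ocoefD !coef_mono eqxx oner_eq0.
  by rewrite add0r => /eqP; rewrite oner_eq0.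
(* With [x] in the role of [w], the reversed polynomial has the inverses [1/y1] as roots. The
   residue of its top coefficient is [P (c0, 0)], which is nonzero. *)
pose f := \poly_(j < n.+1) ev0 x1 P`_(n - j).
have sf i : supp_in (nlat 1) f`_i.
  rewrite coef_poly; case: ifP => _; last exact: supp_in0.
  by apply: supp_in_ev0 => //; [exact: nlat0|exact: nlatD].
have rfn : res f`_n != 0 by rewrite coef_poly leqnn subnn /res (ev0_res _ sx1) x10.
(* This is the leading coefficient of [P] in [y1], taken at the nonconstant [x1]; its nonvanishing
   excludes the root [z = 0]. *)
have f0 : f`_0 != 0.
  rewrite coef_poly /= subn0; apply/eqP => /algebraic_const H.
  have [|c /x1nc //] := H _.
  by rewrite -/n -lead_coefE lead_coef_eq0.
have szr : size (map_poly (@res R) f) = n.+1.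
  apply/eqP; rewrite eqn_leq; apply/andP; split.
    by apply/leq_sizeP => j nj; rewrite coef_map /= coef_poly ltnNge nj.
  by apply: contraNltn rfn => /leq_sizeP/(_ n (leqnn n)); rewrite coef_map => ->.
have [c rc] : exists c, root (map_poly (@res R) f) c.
  by apply/closed_rootP; rewrite szr eqSS -lt0n.
have [d [z [d0 sz fz]]] : exists e y, [/\ (0 < e)%N, supp_in (nlat e) y & f.[y] = 0].
  apply: (@root_from_residue R 1 f c n) => //.
  - exact/eqP.
  - rewrite (@horner_coef_wide _ 1).
      by rewrite big_ord1 expr0 mulr1 coef_nderivn addn0 binn coef_map.
    apply/leq_sizeP => -[|j] // _; rewrite coef_nderivn nth_default ?mul0rn//.
    by rewrite szr addnS ltnS leq_addr.
  - by move=> m /andP[m0 _]; exact: newton_puiseux.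
have [p zp pmin] : exists2 p, cf d z p != 0 & forall k, (k < p)%N -> cf d z k = 0.
  have ex : exists k, cf d z k != 0.
    have [|mu zmu _] := @lead_exists R z.
      by apply: contraNneq f0 => z0; move: fz; rewrite z0 horner_coef0 => ->.
    by have [k kE] := sz _ zmu; exists k; rewrite /cf -kE.
  case: (ex_minnP ex) => p zp pmin; exists p => // k kp; apply/eqP.
  by apply: contraTT kp => /pmin; rewrite -leqNgt.
pose N := (d + p)%N.
have N0 : (0 < N)%N by rewrite addn_gt0 d0.
(* Coefficients of the primitive of [zeta (t) d t^(d-1)], where [zeta] is [cf d z]; its order is
   [N = d + p]. *)
pose eta k : C := if (k < d)%N then 0 else d%:R * cf d z (k - d)%N / k%:R.
have eta0 k : (k < N)%N -> eta k = 0.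
  move=> kN; rewrite /eta; case: (ltnP k d) => // dk.
  have kp : (k - d < p)%N by rewrite ltn_subLR.
  by rewrite (pmin _ kp) mulr0 mul0r.
have etaN : eta N != 0.
  rewrite /eta ltnNge leq_addr /= /N addnC addnK addnC.
  by rewrite !mulf_neq0 ?invr_neq0 ?pnatr_eq0 -?lt0n.
have [u mu uH] := psubst_inverse N0 eta0 etaN.
have [su u0] := mu; have vu := maxid_vge N0 mu.
have [W uW] := psubst_exists N0 (cf d z) vu.
have [W1 uW1] := psubst_exists N0 (fun k => k.+1%:R * eta k.+1) vu.
have iN0 : 0 < N%:R^-1 :> R by rewrite invr_gt0 ltr0n.
have DH : W1 * oD u = 1.
  rewrite -(psubst_oD N0 vu uH uW1); apply: omegaP => m.
  rewrite coef_oD coef_mono ocoef1 -subr_eq0 addrK.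
  by case: eqP => [->|_]; rewrite ?mulr0// add0r mulr1.
have W1E : W1 = oC d%:R * u ^+ d.-1 * W.
  apply/eqP; rewrite -subr_eq0; apply/eqP; apply: (vge_eq0_nat iN0) => K.
  have trE : ev0 u (trunc (d.-1 + K) (fun k => k.+1%:R * eta k.+1)) =
      oC d%:R * u ^+ d.-1 * ev0 u (trunc K (cf d z)).
    rewrite !ev0_trunc big_split_ord /= big1 ?add0r => [|k _].
      rewrite mulr_sumr; apply: eq_bigr => k _.
      have -> : (d.-1 + k).+1%:R * eta (d.-1 + k).+1 = d%:R * cf d z k.
        rewrite -addSn prednK// /eta ltnNge leq_addr /= addnC addnK.
        by rewrite mulrC divfK// pnatr_eq0 addn_eq0 negb_and -!lt0n d0 orbT.
      rewrite exprD rmorphM /=; ring.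
    by rewrite /eta -[X in (_ < X)%N](prednK d0) ltnS ltn_ord mulr0 rmorph0 mul0r.
  have -> : W1 - oC d%:R * u ^+ d.-1 * W =
     (W1 - ev0 u (trunc (d.-1 + K) (fun k => k.+1%:R * eta k.+1))) -
     oC d%:R * (u ^+ d.-1 * (W - ev0 u (trunc K (cf d z)))) by rewrite trE; ring.
  apply: vgeB.
    by apply: (vgeW _ (uW1 _)); rewrite ler_wpM2r ?(ltW iN0)// ler_nat leq_addl.
  apply: vge_oCM; rewrite -[X in vge _ X]add0r; apply: vgeM => //.
  by apply: (vgeW _ (@vge_expN R N u d.-1 vu)); rewrite mulr_ge0// ltW.
(* Undoes [t = w^(1/d)] with [t = u]; the derivative of [s] is then the inverse of
   [zeta (u) = W]. *)
pose s := oC c0 + u ^+ d.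
have ud0 : (u ^+ d) 0 = 0.
  by apply: (@vge_expN R N u d vu); rewrite mulr_gt0// ltr0n.
have Ds : oD s * W = 1.
  have uD : u ^+ d = ev0 u 'X^d by rewrite rmorphXn /= ev0X.
  rewrite /s oDD oD_oC add0r uD (derivation_ev0 _ _ (derivation_oD R)) derivXn.
  by rewrite -DH W1E raddfMn /= rmorphXn /= ev0X rmorph_nat -mulr_natl; ring.
exists s; split.
- apply/is_solutionE.
  pose B j := P`_(n - j) \Po (c0%:P + 'X^d).
  have BE v j : ev0 v (B j) = ev0 (oC c0 + v ^+ d) P`_(n - j).
    by rewrite /B ev0_comp rmorphD rmorphXn /= ev0C ev0X.
  have := @psubst_relation R N N0 d n.+1 B z u W d0 sz _ vu uW.
  rewrite /coefpoly !horner_poly => relW.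
  have {}relW : \sum_(i < n.+1) ev0 u (B i) * W ^+ i = 0.
    apply: relW; rewrite -[RHS]fz /f horner_poly; apply: eq_bigr => i _.
    by rewrite BE monoX -(mulr_natr d%:R^-1 d) mulVf// pnatr_eq0 -lt0n.
  (* Multiplying by the [n]-th power of [oD s], the inverse of [W], undoes the reversal of [P]. *)
  transitivity (oD s ^+ n * \sum_(i < n.+1) ev0 u (B i) * W ^+ i); last first.
    by rewrite relW mulr0.
  rewrite (@ev_sum0 _ P s (oD s) n.+1) ?szP// (reindex_inj rev_ord_inj) /= mulr_sumr.
  apply: eq_bigr => i _; rewrite BE subSS -/s.
  have iN : (i <= n)%N by rewrite -ltnS.
  have -> : oD s ^+ n = oD s ^+ (n - i) * oD s ^+ i by rewrite -exprD subnK.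
  rewrite -[LHS]mulr1 -(expr1n _ i) -Ds exprMn; ring.
- have ss : supp_in (nlat N) s.
    apply: supp_inD; first by apply: supp_in_oC; exact: nlat0.
    by apply: supp_inX => //; [exact: nlat0|exact: nlatD].
  by move=> m /ss[k ->]; rewrite divr_ge0.
- by rewrite ocoefD coef_mono eqxx ud0 addr0.
Qed.

End Existence.

Theorem theorem4 (R : realType) (P : {poly {poly R[i]}}) :
  P != 0 -> (1 < size P)%N ->
  [/\ (forall s : gseries R, in_Omega s -> is_solution P s -> is_puiseux s),
      (forall s : gseries R, in_Omega s -> is_puiseux s -> is_solution P s ->
         convergent_puiseux s) &
      (forall x0 c0 : R[i], exists s : gseries R,
         [/\ in_Omega s, is_solution P s, convergent_puiseux s,
             (forall m : R, s m != 0 -> 0 <= m) & s 0 = c0])].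
Proof.
move=> P0 sP; split.
- by move=> s so sol; exact: (@omega_solution_puiseux R P (MkOmega so)).
- by move=> s so ps sol; exact: (@puiseux_solution_converges R P (MkOmega so)).
(* The equation is autonomous: a series with value [c0] at the origin, read in [x - x0], passes
   through the point [(x0, c0)]. *)
- move=> x0 c0; have [s [sol s_ge0 s0]] := solution_exists c0 P0 sP.
  exists s; split=> //; first exact: oserP.
  by apply: (puiseux_solution_converges P0) => //; exact: omega_solution_puiseux sol.
Qed.
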